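(* Let $n\in\mathbb N$ and let $K\subseteq\mathbb R^n$ be an origin-symmetric convex set with nonempty interior. Let $u:\mathbb R^n\to\mathbb R$ be a $C^2$ even function (i.e. $u(-x)=u(x)$) satisfying $\mathscr{L}u=1$ on $K$, where $\mathscr{L}u(x)=\Delta u(x)-\sum_{i=1}^n x_i\partial_iu(x)$. Then $$\int \|\nabla^2u\|_{\mathrm{HS}}^2 + |\nabla u|^2 \,\mathrm{d}\gamma_K \geq \frac{1}{n}.$$
   Context: $\gamma_n$ is the standard Gaussian measure on $\mathbb R^n$ with density $(2\pi)^{-n/2}e^{-|x|^2/2}$. For a set $K$ of positive Gaussian measure, $\gamma_K$ is the probability measure $\gamma_K(A)=\gamma_n(A\cap K)/\gamma_n(K)$. $\nabla^2u$ is the Hessian of $u$ and $\|A\|_{\mathrm{HS}}^2=\sum_{i,j}a_{ij}^2$ is the squared Hilbert–Schmidt norm of a matrix $A$. *)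

(* Defs.v *)
From HB Require Import structures.
From mathcomp Require Import all_boot all_order all_algebra.
From mathcomp Require Import all_classical all_reals all_analysis.
Set Implicit Arguments. Unset Strict Implicit. Unset Printing Implicit Defensive.
Import Order.TTheory GRing.Theory Num.Theory.
Import numFieldNormedType.Exports.
Local Open Scope classical_set_scope.
Local Open Scope ring_scope.

Section Defs.
Context {R : realType} {n : nat}.

Definition evec (i : 'I_n) : 'rV[R]_n := \row_(j < n) (i == j)%:R.

Definition pd (i : 'I_n) (u : 'rV[R]_n -> R) : 'rV[R]_n -> R :=
  fun x => 'D_(evec i) u x.

Definition grad (u : 'rV[R]_n -> R) (x : 'rV[R]_n) : 'rV[R]_n :=
  \row_(i < n) pd i u x.
Definition hessian (u : 'rV[R]_n -> R) (x : 'rV[R]_n) : 'M[R]_n :=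
  \matrix_(i < n, j < n) pd i (pd j u) x.

Definition hs_norm2 (A : 'M[R]_n) : R := \sum_(i < n) \sum_(j < n) A i j ^+ 2.
Definition eucl_norm2 (v : 'rV[R]_n) : R := \sum_(i < n) v 0 i ^+ 2.

Definition C2 (u : 'rV[R]_n -> R) : Prop :=
  (forall x, differentiable u x) /\
  (forall i x, differentiable (pd i u) x) /\
  (forall i j, continuous (pd i (pd j u))).

Definition laplacian (u : 'rV[R]_n -> R) (x : 'rV[R]_n) : R :=
  \sum_(i < n) pd i (pd i u) x.
Definition OU (u : 'rV[R]_n -> R) (x : 'rV[R]_n) : R :=
  laplacian u x - \sum_(i < n) x 0 i * pd i u x.

Definition origin_symmetric (K : set 'rV[R]_n) : Prop :=
  forall x, K x -> K (- x).

End Defs.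

Notation gamma1 := (@normal_prob _ 0 1).

(* Integral against the standard Gaussian measure gamma_n on R^n, for
   nonnegative integrands, computed as an iterated integral of the
   coordinates (equal to the product-measure integral by Tonelli). *)
Fixpoint gauss_iter {R : realType} (k : nat) (F : (nat -> R) -> \bar R)
    (x : nat -> R) : \bar R :=
  match k with
  | 0 => F x
  | k'.+1 => (\int[gamma1]_(t in [set: R])
                gauss_iter k' F (fun j => if j == k' then t else x j))%E
  end.

Definition gauss_int {R : realType} (n : nat) (f : 'rV[R]_n -> \bar R) : \bar R :=
  gauss_iter n (fun x => f (\row_(i < n) x (i : nat))) (fun _ => 0).

Definition gamma_n {R : realType} (n : nat) (K : set 'rV[R]_n) : \bar R :=
  gauss_int (fun x => (\1_K x)%:E).

Definition gammaK_int {R : realType} (n : nat) (K : set 'rV[R]_n)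
    (f : 'rV[R]_n -> \bar R) : \bar R :=
  (gauss_int (fun x => (\1_K x)%:E * f x) * ((fine (gamma_n K))^-1)%:E)%E.

(* Main.v *)
Require Import Defs.
From HB Require Import structures.
From mathcomp Require Import all_boot all_order all_algebra.
From mathcomp Require Import all_classical all_reals all_analysis.
From mathcomp Require Import measurable_realfun ring lra.
Import Order.TTheory GRing.Theory Num.Theory.
Import numFieldNormedType.Exports.
Import HBNNSimple.
Local Open Scope classical_set_scope.
Local Open Scope ring_scope.

(** Write [u = |x|^2 / (2 n) + v].  Using [OU u = 1], the integrand equals
    [1/n + |x|^2/n^2 + 2 |grad u|^2 + sum_j (|grad (d_j v)|^2 - (d_j v)^2)]
    on [K], so it suffices that [\int w^2 <= \int |grad w|^2] for the odd
    functions [w = d_j v].  This Poincare inequality, for an even log-concave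
    weight [psi] times the Gaussian, is the linearisation of the
    Prekopa-Leindler inequality applied to
    [psi (1 + e w + e^2 (w^2 - |grad w|^2 - d))], [psi (1 - e w)] and [psi]:
    oddness kills the terms of order [e], and [w x - w y] is compared with the
    Gaussian gain [|x - y|^2 / 4].  The weights are continuous cutoffs built
    from the distance to the complement of the bounded pieces of [K], which
    keeps all integrands continuous and bounded.

    MathComp-Analysis integrates an arbitrary nonnegative function by taking
    the supremum over simple functions below it.  Prekopa-Leindler holds for
    this lower integral without any measurability assumption, hence passes to
    [gauss_iter] by a plain induction; this also disposes of the fact
    that [K] need not be a Borel set.  Passing from cutoffs to [K] again uses Prekopa-Leindler:
    midpoints of [K] and of the support of a cutoff stay inside a larger
    cutoff. *)

Set Implicit Arguments. Unset Strict Implicit. Unset Printing Implicit Defensive.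

(** * Prekopa-Leindler on the line *)

Section lower_integral.
Context d (T : measurableType d) (R : realType).
Variable mu : {measure set T -> \bar R}.
Local Open Scope ereal_scope.

(** The integral of a nonnegative function is a supremum over simple functions, and those below [f]
    are also below [g]; hence no measurability assumption. *)
Lemma le_lower_integral (f g : T -> \bar R) :
  (forall x, 0 <= f x) -> (forall x, f x <= g x) ->
  \int[mu]_x f x <= \int[mu]_x g x.
Proof.
move=> f0 fg; have g0 x : 0 <= g x by exact: le_trans (f0 x) (fg x).
rewrite !ge0_integralTE//; apply: le_ereal_sup => _ [h /= hf <-].
by exists h => // x; exact: le_trans (hf x) (fg x).
Qed.

(** The least-upper-bound side of the same supremum: it reduces upper bounds for arbitrary
    integrands to measurable simple ones. *)
Lemma lower_integral_le (f : T -> \bar R) (c : \bar R) :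
  (forall x, 0 <= f x) ->
  (forall h : {nnsfun T >-> R}, (forall x, (h x)%:E <= f x) ->
    \int[mu]_x (h x)%:E <= c) ->
  \int[mu]_x f x <= c.
Proof.
move=> f0 fc; rewrite ge0_integralTE//; apply: ge_ereal_sup => _ [h /= hf <-].
by rewrite -integralT_nnsfun; exact: fc.
Qed.

End lower_integral.

(** * Brunn-Minkowski on the line *)

Section one_dimensional_sum.
Context {R : realType}.
Notation leb := (@lebesgue_measure R).

Lemma measurable_half (A : set R) (c : R) : measurable A ->
  measurable ((fun z : R => 2 * z - c) @^-1` A).
Proof.
move=> mA; rewrite -[X in measurable X]setTI.
have : measurable_fun setT (fun z : R => 2 * z - c).
  by apply: measurable_funB => //; exact: measurable_funM.
by apply.
Qed.

(** Twice the pushforward of Lebesgue measure under [z |-> 2 * z - c] is a measure giving each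
    interval its length, so uniqueness of Lebesgue measure applies. *)
Lemma lebesgue_measure_half (A : set R) (c : R) : measurable A ->
  (2%:E * leb ((fun z : R => 2 * z - c)%R @^-1` A) = leb A)%E.
Proof.
move=> mA.
have mphi : measurable_fun setT (fun z : measurableTypeR R => 2 * z - c : measurableTypeR R).
  by apply: measurable_funB => //; exact: measurable_funM.
pose phiM := isMeasurableFun.Build _ _ _ _ _ mphi.
pose phi : {mfun measurableTypeR R >-> measurableTypeR R} :=
  HB.pack (fun z : measurableTypeR R => 2 * z - c : measurableTypeR R) phiM.
have nuE : exists nu : {measure set (measurableTypeR R) -> \bar R},
    forall A, nu A = (2%:E * leb (phi @^-1` A))%E.
  by eexists (mscale (NngNum (ler0n R 2)) (pushforward leb phi)).
have {nuE}[nu nuE] := nuE.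
transitivity (nu A); first by rewrite nuE.
apply/esym/lebesgue_measure_unique => // X [[a b] _ <-] /=.
rewrite nuE/=.
rewrite (_ : _ @^-1` _ = `](a + c) / 2, (b + c) / 2]%classic).
  rewrite !lebesgue_measure_itv/= !lte_fin ltr_pM2r ?ltrD2r//.
  by case: ifP => ab; rewrite ?mule0// -EFinM; congr EFin; field.
by apply/seteqP; split => x /=; rewrite !in_itv/= => /andP[? ?]; apply/andP; split; lra.
Unshelve. exact: mphi.
Qed.

(** Inner regularity gives a compact [V] inside [A] missing measure less than [e]. Its maximum
    serves as [x], since points of [A] further right lie outside [V]. If [V] is empty, [A] itself is
    small and any of its points works. *)
Lemma exists_near_right (A : set R) (e : R) : measurable A -> A !=set0 ->
  (leb A < +oo)%E -> 0 < e ->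
  exists2 x, A x & (leb (A `&` `]x, +oo[%classic) <= e%:E)%E.
Proof.
move=> mA [a Aa] Afin e0.
have [V [cV VA Ve]] := lebesgue_regularity_inner mA Afin e0.
have mV : measurable V by exact: compact_measurable.
have [V0|/set0P[v Vv]] := eqVneq V set0.
  exists a => //; apply: (le_trans _ (ltW Ve)); rewrite V0 setD0.
  by apply: le_measure; rewrite ?inE//; apply: measurableI.
have [x] : exists2 x, V x & forall y, V y -> y <= x.
  have bV : has_sup V.
    split; first by exists v.
    have [M [_ MV]] := compact_bounded cV.
    exists (M + 1) => y Vy; apply: (le_trans (ler_norm y)).
    by apply: MV => //; rewrite ltrDl.
  exists (sup V); last by move=> y Vy; apply: ub_le_sup => //; case: bV.
  have := closure_sup bV.1 bV.2.
  by rewrite -((closure_id V).1 (compact_closed (@Rhausdorff R) cV)).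
move=> Vx maxx; exists x; first exact: VA.
apply: (le_trans _ (ltW Ve)); apply: le_measure; rewrite ?inE//.
- exact: measurableI.
- exact: measurableD.
move=> y /= []; rewrite in_itv/= andbT => Ay xy; split => // /maxx.
by rewrite leNgt xy.
Qed.

(** Reflection of [exists_near_right]. *)
Lemma exists_near_left (A : set R) (e : R) : measurable A -> A !=set0 ->
  (leb A < +oo)%E -> 0 < e ->
  exists2 x, A x & (leb (A `&` `]-oo, x[%classic) <= e%:E)%E.
Proof.
move=> mA [a Aa] Afin e0.
have mN (X : set R) : measurable X -> measurable (-%R @^-1` X).
  by move=> mX; rewrite -[X in measurable X]setTI; exact: oppr_measurable.
have A'fin : (leb (-%R @^-1` A) < +oo)%E.
  have := lebesgue_measureN mA.
  rewrite /pushforward/= => ->//.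
have [|x Ax xe] := exists_near_right (mN _ mA) _ A'fin e0.
  by exists (- a); rewrite /= opprK.
exists (- x) => //; apply: le_trans xe.
have := @lebesgue_measureN R (A `&` `]-oo, (- x)%R[%classic).
rewrite /pushforward/= => <-; last by apply: measurableI.
apply: le_measure; rewrite ?inE.
- by apply: mN; apply: measurableI.
- by apply: measurableI => //; exact: mN.
by move=> y /= []; rewrite !in_itv/= andbT => Ay; rewrite ltrN2.
Qed.

(* One-dimensional Brunn-Minkowski: [A + b] and [a + B] almost lie on either side
   of [a + b] when [a] is near the right end of [A] and [b] near the left end of
   [B]. Building the subset [C] of [(A + B) / 2] this way keeps it measurable. *)
Lemma half_sum_measure (A B : set R) (e : R) :
  measurable A -> measurable B -> A !=set0 -> B !=set0 ->
  (leb A < +oo)%E -> (leb B < +oo)%E -> 0 < e ->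
  exists C : set R, [/\ measurable C,
    (forall z, C z -> exists x y, [/\ A x, B y & z = (x + y) / 2]) &
    (leb A + leb B <= 2%:E * leb C + e%:E)%E].
Proof.
move=> mA mB A0 B0 Af Bf e0.
have e20 : 0 < e / 2 by rewrite divr_gt0.
have [a Aa ae] := exists_near_right mA A0 Af e20.
have [b Bb be] := exists_near_left mB B0 Bf e20.
(* [B1] is open at [b], so that the halves [C1] and [C2] are separated by [(a + b) / 2] and hence
   disjoint; the lost point [b] is null. *)
set A1 := A `&` `]-oo, a]%classic; set B1 := B `&` `]b, +oo[%classic.
have mA1 : measurable A1 by exact: measurableI.
have mB1 : measurable B1 by exact: measurableI.
set C1 := (fun z : R => 2 * z - b) @^-1` A1.
set C2 := (fun z : R => 2 * z - a) @^-1` B1.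
have mC1 : measurable C1 by exact: measurable_half.
have mC2 : measurable C2 by exact: measurable_half.
exists (C1 `|` C2); split; first exact: measurableU.
- move=> z [|] [].
  + by exists (2 * z - b), b; split => //; field.
  + by exists a, (2 * z - a); split => //; field.
- have -> : leb (C1 `|` C2) = (leb C1 + leb C2)%E.
    apply: measureU => //; rewrite -subset0 => z [] [_ /=] + [_ /=].
    by rewrite !in_itv/= andbT; lra.
  rewrite ge0_muleDr// !lebesgue_measure_half//.
  have HA : (leb A <= leb A1 + (e / 2)%:E)%E.
    rewrite (_ : A = A1 `|` (A `&` `]a, +oo[%classic)).
      rewrite measureU//; first by rewrite leeD2l.
        exact: measurableI.
      rewrite -subset0 => z [] [_ /=] + [_ /=].
      by rewrite !in_itv/= andbT; lra.
    rewrite -setIUr; apply/seteqP; split => z /=; last by case.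
    by move=> Az; split=> //; rewrite !in_itv/= andbT; case: leP; [left|right].
  have HB : (leb B <= leb B1 + (e / 2)%:E)%E.
    rewrite (_ : leb B = leb (B `\ b)); last first.
      rewrite -[in LHS](@setD1K _ b B)// setUC measureU0//.
        by apply: measurableD.
      exact: lebesgue_measure_set1.
    rewrite (_ : B `\ b = B1 `|` (B `&` `]-oo, b[%classic)).
      rewrite measureU//; first by rewrite leeD2l.
        exact: measurableI.
      rewrite -subset0 => z [] [_ /=] + [_ /=].
      by rewrite !in_itv/= andbT; lra.
    rewrite -setIUr; apply/seteqP; split => z /=.
      move=> [Bz zb]; split=> //; rewrite !in_itv/= andbT.
      by case: (ltgtP z b); [right|left|].
    by move=> [Bz []]; rewrite in_itv/= ?andbT => zb; split => // E; move: zb; rewrite E ltxx.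
  apply: (le_trans (leeD HA HB)).
  by rewrite addeACA -EFinD -splitr.
Qed.

End one_dimensional_sum.

(** * Gaussian integrals through the Lebesgue density *)

Section gaussian_density.
Context {R : realType}.
Notation leb := (@lebesgue_measure R).
Notation pdf := (@normal_pdf R 0 1).
Local Open Scope ereal_scope.

Lemma gamma1E (A : set R) : gamma1 A = \int[leb]_(x in A) (pdf x)%:E.
Proof. by []. Qed.

Lemma normal_pdf_gt0 (x : R) : (0 < pdf x)%R.
Proof.
rewrite normal_pdfE ?oner_eq0// mulr_gt0 ?expR_gt0//.
by rewrite normal_peak_gt0// oner_eq0.
Qed.

(** Parallelogram identity in the exponent. This quantifies the strict log-concavity of the Gaussian
    and is the source of the gain [(x - y) ^+ 2 / 4]. *)
Lemma normal_pdf_mid (x y : R) :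
  (pdf x * pdf y = pdf ((x + y) / 2) ^+ 2 * expR (- ((x - y) ^+ 2 / 4)))%R.
Proof.
rewrite !normal_pdfE ?oner_eq0//= /normal_fun !subr0.
rewrite exprMn mulrACA -[in RHS]mulrA expr2; congr (_ * _)%R.
by rewrite [in RHS]expr2 -!expRD; congr (expR _); field.
Qed.

Lemma integral_gamma1_indic (E : set R) : measurable E ->
  \int[gamma1]_x (\1_E x)%:E = \int[leb]_x ((\1_E x)%:E * (pdf x)%:E).
Proof.
move=> mE; rewrite integral_indic//= setIT gamma1E integral_mkcond/=.
apply: eq_integral => x _; rewrite patchE indicE; case: ifPn => xE.
  by rewrite mul1e.
by rewrite mul0e.
Qed.

Lemma integral_gamma1_nnsfun (f : {nnsfun measurableTypeR R >-> R}) :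
  \int[gamma1]_x (f x)%:E = \int[leb]_x ((f x)%:E * (pdf x)%:E).
Proof.
have mpdf : measurable_fun setT (fun x : measurableTypeR R => (pdf x)%:E).
  by apply/measurable_EFinP; exact: measurable_normal_pdf.
under [LHS]eq_integral do rewrite fimfunE -fsumEFin//.
rewrite [LHS]ge0_integral_fsum//; last 2 first.
  - by move=> r; exact/measurable_EFinP/measurableT_comp.
  - by move=> n x _; rewrite EFinM nnfun_muleindic_ge0.
under [RHS]eq_integral.
  move=> x _; rewrite fimfunE -fsumEFin// ge0_mule_fsuml; last first.
    by move=> r; rewrite EFinM nnfun_muleindic_ge0.
  over.
rewrite [RHS]ge0_integral_fsum//; last 2 first.
  - move=> r; apply: emeasurable_funM => //.
    exact/measurable_EFinP/measurableT_comp.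
  - move=> n x _; rewrite mule_ge0 ?lee_fin ?normal_pdf_ge0//.
    by have := @nnfun_muleindic_ge0 _ _ _ f n x; rewrite -EFinM lee_fin.
apply: eq_fsbigr => r /[!inE] -[x _ <-].
under [in RHS]eq_integral do rewrite EFinM -muleA.
under eq_integral do rewrite EFinM.
rewrite !ge0_integralZl//.
- congr (_ * _); apply: integral_gamma1_indic.
  have mf : measurable_fun setT (f : measurableTypeR R -> R) by [].
  by rewrite -[X in measurable X]setTI; apply: mf.
- by apply: emeasurable_funM => //; exact/measurable_EFinP/measurable_indic.
- by move=> y _; rewrite mule_ge0 ?lee_fin ?normal_pdf_ge0.
- by rewrite lee_fin.
- exact/measurable_EFinP/measurable_indic.
- by rewrite lee_fin.
Qed.

(** Monotone convergence along simple approximations reduces this to indicators, where it is the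
    definition of the Gaussian measure. *)
Lemma integral_gamma1 (f : measurableTypeR R -> \bar R) :
  measurable_fun setT f -> (forall x, 0 <= f x) ->
  \int[gamma1]_x f x = \int[leb]_x (f x * (pdf x)%:E).
Proof.
move=> mf f0.
have mpdf : measurable_fun setT (fun x : measurableTypeR R => (pdf x)%:E).
  by apply/measurable_EFinP; exact: measurable_normal_pdf.
pose f_ := nnsfun_approx measurableT mf.
have cf x : (f_ n x)%:E @[n --> \oo] --> f x.
  by apply: cvg_nnsfun_approx => // *; exact: f0.
transitivity (limn (fun n => \int[gamma1]_x (f_ n x)%:E)).
  rewrite -monotone_convergence//.
  - by apply: eq_integral => y _; apply/esym/cvg_lim => //; exact: cf.
  - by move=> n; exact/measurable_EFinP/measurable_funP.
  - by move=> n y _; rewrite lee_fin.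
  - by move=> y _ m n mn; rewrite lee_fin; exact/lefP/nd_nnsfun_approx.
under eq_fun do rewrite integral_gamma1_nnsfun.
rewrite -monotone_convergence//.
- apply: eq_integral => y _; apply/cvg_lim => //.
  by apply: cvgeZr => //; exact: cf.
- move=> n; apply: emeasurable_funM => //.
  exact/measurable_EFinP/measurable_funP.
- by move=> n y _; rewrite mule_ge0 ?lee_fin ?normal_pdf_ge0.
- move=> y _ m n mn; rewrite lee_wpmul2r ?lee_fin ?normal_pdf_ge0//.
  exact/lefP/nd_nnsfun_approx.
Qed.

End gaussian_density.

(** * Discrete layer-cake sums *)

Section levels.
Context {R : realType}.

Lemma sum_levels_le (m : nat) (t : R) : 0 <= t ->
  \sum_(i < m) ((i.+1)%:R <= t :> R)%:R <= t.
Proof.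
move=> t0; elim: m => [|m IH]; first by rewrite big_ord0.
rewrite big_ord_recr/=; case: (leP (m.+1)%:R t) => mt; last by rewrite addr0.
apply: le_trans mt; rewrite -natr1 lerD2r.
rewrite -[leRHS](_ : \sum_(i < m) 1 = _); last by rewrite sumr_const card_ord.
by apply: ler_sum => i _; rewrite lern1 leq_b1.
Qed.

(** The sum counts the integers among [1, ..., m] strictly below [t]; at most one unit is lost,
    which becomes the error [1 / (m + 1)] in [level_sum_ge]. *)
Lemma sum_levels_ge (m : nat) (t : R) : t <= (m.+1)%:R ->
  t <= 1 + \sum_(i < m) ((i.+1)%:R < t :> R)%:R.
Proof.
elim: m t => [|m IH] t tm; first by rewrite big_ord0 addr0.
case: (ltP (m.+1)%:R t) => mt; last first.
  by apply: (le_trans (IH _ mt)); rewrite lerD2l big_ord_recr/= lerDl ler0n.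
apply: (le_trans tm); rewrite -natr1 addrC lerD2l.
rewrite (eq_bigr (fun=> 1)) ?sumr_const ?card_ord// => i _.
by rewrite (le_lt_trans _ mt)// ler_nat ltn_ord.
Qed.

(* Riemann sum of the layer-cake formula [a = \int_0^1 1_{s < a} ds] for
   [0 <= a <= 1]. *)
Definition level_sum (m : nat) (a : R) : R :=
  (m.+1)%:R^-1 * \sum_(i < m) ((i.+1)%:R / (m.+1)%:R < a :> R)%:R.

Lemma level_sum_ge0 m a : 0 <= level_sum m a.
Proof. by rewrite mulr_ge0// sumr_ge0. Qed.

Lemma level_sum_le m a : 0 <= a -> level_sum m a <= a.
Proof.
move=> a0; rewrite /level_sum ler_pdivrMl//.
apply: le_trans (sum_levels_le m (mulr_ge0 (ler0n _ m.+1) a0)).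
apply: ler_sum => i _; rewrite ler_nat; case: ltP => //.
by rewrite ltr_pdivrMr// mulrC => /ltW ->.
Qed.

Lemma level_sum_ge m a : a <= 1 -> a - (m.+1)%:R^-1 <= level_sum m a.
Proof.
move=> a1; rewrite lerBlDr /level_sum -[X in _ + X]mulr1 -mulrDr.
rewrite ler_pdivlMl// addrC (le_trans (@sum_levels_ge m _ _))//.
  by rewrite ler_piMr.
rewrite lerD2l; apply: ler_sum => i _.
by rewrite ltr_pdivrMr// mulrC.
Qed.

Lemma cvg_level_sum a : 0 <= a <= 1 -> level_sum ^~ a @ \oo --> a.
Proof.
move=> /andP[a0 a1].
apply: (@squeeze_cvgr _ _ _ _ (fun m => a - (m.+1)%:R^-1) (cst a)).
- by apply: nearW => m; rewrite level_sum_ge//= level_sum_le.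
- rewrite -[X in _ --> X]subr0; apply: cvgB; first exact: cvg_cst.
  exact: cvg_harmonic.
- exact: cvg_cst.
Qed.

End levels.

(** * Prekopa-Leindler for Lebesgue measure *)

Section prekopa_leindler_line.
Context {R : realType}.
Notation leb := (@lebesgue_measure R).
Local Open Scope ereal_scope.

Lemma measurable_superlevel (a : measurableTypeR R -> R) (s : R) :
  measurable_fun setT a -> measurable [set x | (s < a x)%R].
Proof.
move=> ma; rewrite (_ : [set _ | _] = a @^-1` `]s, +oo[%classic).
  by rewrite -[X in measurable X]setTI; exact: ma.
by apply/seteqP; split => x /=; rewrite in_itv/= andbT.
Qed.

Lemma measurable_level_sum m (a : measurableTypeR R -> R) :
  measurable_fun setT a -> measurable_fun setT (fun x => level_sum m (a x)).
Proof.
move=> ma; apply: measurable_funM => //; apply: measurable_sum => i.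
rewrite (_ : (fun x => _) = \1_[set x | ((i.+1)%:R / (m.+1)%:R < a x)%R]).
  by apply: measurable_indic; exact: measurable_superlevel.
by apply/funext => x; rewrite indicE mem_setE.
Qed.

Lemma integral_level_sum m (a : measurableTypeR R -> R) :
  measurable_fun setT a ->
  \int[leb]_x (level_sum m (a x))%:E =
  (m.+1%:R^-1)%:E * \sum_(i < m) leb [set x | ((i.+1)%:R / (m.+1)%:R < a x)%R].
Proof.
move=> ma; under eq_integral do rewrite EFinM -sumEFin.
have mi (i : 'I_m) : measurable_fun setT
    (fun x : measurableTypeR R => (((i.+1)%:R / (m.+1)%:R < a x)%R%:R : R)%:E).
  apply/measurable_EFinP.
  rewrite (_ : (fun x => _) = \1_[set x | ((i.+1)%:R / (m.+1)%:R < a x)%R]).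
    by apply: measurable_indic; exact: measurable_superlevel.
  by apply/funext => x; rewrite indicE mem_setE.
rewrite ge0_integralZl//; last first.
- by move=> x _; rewrite sume_ge0// => i _; rewrite lee_fin.
- by apply: emeasurable_sum => i.
rewrite ge0_integral_sum//.
congr (_ * _); apply: eq_bigr => i _.
rewrite -[in RHS](setTI [set x | _]) setIC.
rewrite -[RHS]integral_indic//; last exact: measurable_superlevel.
by apply: eq_integral => x _; rewrite indicE mem_setE.
Qed.

(** Markov's inequality. *)
Lemma superlevel_lty (a : measurableTypeR R -> R) (s : R) :
  measurable_fun setT a -> (forall x, (0 <= a x)%R) ->
  \int[leb]_x (a x)%:E < +oo -> (0 < s)%R -> leb [set x | (s < a x)%R] < +oo.
Proof.
move=> ma a0 afin s0.
have mS := measurable_superlevel s ma.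
suff : s%:E * leb [set x | (s < a x)%R] < +oo.
  by apply: contraTT; rewrite -!leNgt !leye_eq => /eqP ->; rewrite gt0_muley ?lte_fin.
apply: le_lt_trans afin.
rewrite -[X in _ * leb X](setIT _) -integral_indic// -ge0_integralZl//; last 2 first.
- by apply/measurable_EFinP; exact: measurable_indic.
- by rewrite lee_fin ltW.
apply: le_lower_integral => x; first by rewrite -EFinM lee_fin mulr_ge0// ltW.
rewrite -EFinM lee_fin indicE; case: (boolP (x \in _)) => [/set_mem /= sa|_].
  by rewrite mulr1 ltW.
by rewrite mulr0.
Qed.

(** With both suprema equal to 1, the superlevel sets of [a] and [b] at a common level are nonempty
    together, and their half-sum lies where [c] is at least that level. Brunn-Minkowski at each
    level, summed over finitely many levels, gives the claim. As [c] is arbitrary, its integral is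
    bounded below through measurable sets [C i]. *)
Lemma prekopa_leindler_sum (a b : measurableTypeR R -> R) (c : R -> \bar R) :
  measurable_fun setT a -> measurable_fun setT b ->
  (forall x, (0 <= a x <= 1)%R) -> (forall x, (0 <= b x <= 1)%R) ->
  (forall s, (s < 1)%R -> exists x, (s < a x)%R) ->
  (forall s, (s < 1)%R -> exists x, (s < b x)%R) ->
  \int[leb]_x (a x)%:E < +oo -> \int[leb]_x (b x)%:E < +oo ->
  (forall x, 0 <= c x) ->
  (forall x y, (Num.min (a x) (b y))%:E <= c ((x + y) / 2)%R) ->
  \int[leb]_x (a x)%:E + \int[leb]_x (b x)%:E <= 2%:E * \int[leb]_x (c x).
Proof.
move=> ma mb a01 b01 a1 b1 afin bfin c0 abc.
have a0 x : (0 <= a x)%R by case/andP: (a01 x).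
have b0 x : (0 <= b x)%R by case/andP: (b01 x).
suff lev m : \int[leb]_x (level_sum m (a x))%:E + \int[leb]_x (level_sum m (b x))%:E
    <= 2%:E * \int[leb]_x (c x).
  have dcv (f : measurableTypeR R -> R) : measurable_fun setT f ->
      (forall x, (0 <= f x <= 1)%R) -> \int[leb]_x (f x)%:E < +oo ->
      (\int[leb]_x (level_sum m (f x))%:E) @[m --> \oo] --> \int[leb]_x (f x)%:E.
    move=> mf f01 ffin; apply: (@dominated_cvg _ _ _ _ _ _ _ _ (EFin \o f)) => //.
    - by move=> m; apply/measurable_EFinP; exact: measurable_level_sum.
    - by move=> x _; apply: cvg_EFin; [exact: nearW|exact: cvg_level_sum].
    - apply/integrableP; split; first exact/measurable_EFinP.
      apply: le_lt_trans ffin; apply: le_lower_integral => // x /=.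
      by rewrite lee_fin ger0_norm//; case/andP: (f01 x).
    - move=> m x _ /=; rewrite lee_fin ger0_norm ?level_sum_ge0//.
      by apply: level_sum_le; case/andP: (f01 x).
  have cvs : (fun m => \int[leb]_x (level_sum m (a x))%:E +
      \int[leb]_x (level_sum m (b x))%:E) @ \oo -->
      \int[leb]_x (a x)%:E + \int[leb]_x (b x)%:E.
    apply: cvgeD; [|exact: dcv|exact: dcv].
    by rewrite ge0_adde_def// inE integral_ge0// => x _; rewrite lee_fin.
  by apply: (cvge_le _ cvs); exact: nearW.
apply/lee_addgt0Pr => e e0.
(* The levels lie strictly between 0 and 1: being below 1 makes the superlevel sets nonempty, being
   positive makes their measures finite. *)
have lt1 (i : 'I_m) : ((i.+1)%:R / (m.+1)%:R < 1 :> R)%R.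
  by rewrite ltr_pdivrMr// mul1r ltr_nat ltnS.
have gt0 (i : 'I_m) : (0 < (i.+1)%:R / (m.+1)%:R :> R)%R by rewrite divr_gt0.
pose A (i : 'I_m) := [set x | ((i.+1)%:R / (m.+1)%:R < a x)%R].
pose B (i : 'I_m) := [set x | ((i.+1)%:R / (m.+1)%:R < b x)%R].
have H i := @half_sum_measure R (A i) (B i) e (measurable_superlevel _ ma)
  (measurable_superlevel _ mb) (a1 _ (lt1 i)) (b1 _ (lt1 i))
  (superlevel_lty ma a0 afin (gt0 i)) (superlevel_lty mb b0 bfin (gt0 i)) e0.
have /choice[C HC] := H.
have mC i : measurable (C i) by case: (HC i).
(* If [x] is in [C i], then [i + 1] is at most [(m + 1) * c x]; by [sum_levels_le] there are at most
   [(m + 1) * c x] such indices. *)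
have cC x : ((m.+1)%:R^-1 * \sum_(i < m) \1_(C i) x)%:E <= c x.
  move: (c0 x); case cx : (c x) => [r| |]; [|by move=> _; rewrite leey|by []].
  rewrite !lee_fin => r0; rewrite ler_pdivrMl//.
  apply: le_trans (sum_levels_le m (mulr_ge0 (ler0n _ m.+1) r0)).
  apply: ler_sum => i _; rewrite indicE; case: (boolP (x \in C i)) => // /set_mem xC.
  have [_ /(_ _ xC)[y [z [Ay Bz xyz]]] _] := HC i.
  suff : ((i.+1)%:R / (m.+1)%:R <= r)%R by rewrite ler_pdivrMr// mulrC => ->.
  rewrite -lee_fin -cx xyz; apply: le_trans (abc y z).
  by rewrite lee_fin le_min !ltW.
have intC : \int[leb]_x ((m.+1)%:R^-1 * \sum_(i < m) \1_(C i) x)%:E =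
    (m.+1%:R^-1)%:E * \sum_(i < m) leb (C i).
  under eq_integral do rewrite EFinM -sumEFin.
  have mi (i : 'I_m) : measurable_fun setT (fun x : measurableTypeR R => (\1_(C i) x : R)%:E).
    apply/measurable_EFinP; apply: (@measurable_indic _ (measurableTypeR R)).
    exact: mC.
  rewrite ge0_integralZl//; last first.
  - by move=> x _; rewrite sume_ge0// => i _; rewrite lee_fin.
  - by apply: emeasurable_sum => i.
  rewrite ge0_integral_sum//.
  congr (_ * _); apply: eq_bigr => i _.
  rewrite -[in RHS](setIT (C i)) -[RHS](@integral_indic _ (measurableTypeR R))//; exact: mC.
have lec : (m.+1%:R^-1)%:E * \sum_(i < m) leb (C i) <= \int[leb]_x c x.
  rewrite -intC; apply: le_lower_integral => // x.
  by rewrite lee_fin mulr_ge0// sumr_ge0.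
rewrite !integral_level_sum//.
apply: (@le_trans _ _ (2%:E * ((m.+1%:R^-1)%:E * \sum_(i < m) leb (C i)) + e%:E)); last first.
  by rewrite leeD2r// lee_wpmul2l// lee_fin.
rewrite -ge0_muleDr ?sume_ge0// -big_split/= muleCA.
apply: (@le_trans _ _ ((m.+1%:R^-1)%:E * \sum_(i < m) (2%:E * leb (C i) + e%:E))).
  rewrite lee_wpmul2l ?lee_fin//; apply: lee_sum => i _.
  by case: (HC i).
rewrite big_split/= -ge0_sume_distrr// ge0_muleDr//; last 2 first.
- by rewrite mule_ge0// ?lee_fin// sume_ge0.
- by rewrite sume_ge0// => i _; rewrite lee_fin ltW.
rewrite leeD2l// sumEFin -EFinM lee_fin sumr_const card_ord ler_pdivrMl//.
by rewrite -[X in (X <= _)%R]mulr_natl ler_wpM2r ?ler_nat// ltW.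
Qed.

End prekopa_leindler_line.

(** * Prekopa-Leindler for the Gaussian measure on the line *)

Section prekopa_leindler_gauss.
Context {R : realType}.
Notation leb := (@lebesgue_measure R).
Notation pdf := (@normal_pdf R 0 1).
Local Open Scope ereal_scope.

Lemma nnsfun_ub d (T : measurableType d) (f : {nnsfun T >-> R}) :
  exists M : R, forall x, (f x <= M)%R.
Proof.
have [M [_ HM]] := @simple_bounded _ _ _ f.
by exists (M + 1)%R => x; apply: (le_trans (ler_norm _)); apply: HM; rewrite ?ltrDl.
Qed.

Lemma gamma1_setT : gamma1 [set: R] = 1.
Proof. exact: integral_normal_pdf. Qed.

Lemma integral_nnsfun_gamma1_fin (f : {nnsfun measurableTypeR R >-> R}) :
  \int[gamma1]_x (f x)%:E \is a fin_num.
Proof.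
have [M fM] := nnsfun_ub f.
rewrite ge0_fin_numE; last by apply: integral_ge0 => x _; rewrite lee_fin.
apply: (@le_lt_trans _ _ (\int[gamma1]_x (cst M%:E x : \bar R))).
  by apply: le_lower_integral => x /=; rewrite lee_fin.
have -> := integral_cst (normal_prob 0 1) (@measurableT _ (measurableTypeR R)) M%:E.
by rewrite [X in _ * X]gamma1_setT mule1 ltry.
Qed.

(** A simple function below the weighted [H], divided by the positive continuous density, becomes a
    measurable function below a multiple of [H]. Thus [H] itself may be non-measurable. *)
Lemma lower_integral_density (s : R) (H : R -> \bar R) : (0 < s)%R ->
  (forall x, 0 <= H x) ->
  \int[leb]_x ((s^-1)%:E * (H x * (pdf x)%:E)) <= (s^-1)%:E * \int[gamma1]_x H x.
Proof.
move=> s0 H0; apply: lower_integral_le => [x|h hH].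
  by rewrite !mule_ge0 ?lee_fin ?invr_ge0 ?normal_pdf_ge0// ltW.
rewrite lee_pdivlMl//.
have pdf0 x : (0 < pdf x)%R by exact: normal_pdf_gt0.
have mpdf : measurable_fun setT (fun x : measurableTypeR R => (pdf x)^-1%R).
  apply: continuous_measurable_fun => x.
  apply: cvgV; first by rewrite gt_eqF.
  by apply: continuous_normal_pdf; rewrite oner_eq0.
have mh : measurable_fun setT (fun x : measurableTypeR R => (h x / pdf x)%R%:E).
  by apply/measurable_EFinP; exact: measurable_funM.
have -> : \int[leb]_x (h x)%:E = \int[gamma1]_x (h x / pdf x)%R%:E.
  rewrite integral_gamma1//; last by move=> x; rewrite lee_fin divr_ge0// ltW.
  by apply: eq_integral => x _; rewrite -EFinM divfK// gt_eqF.
rewrite -ge0_integralZl//; last 2 first.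
- by move=> x _; rewrite lee_fin divr_ge0// ltW.
- by rewrite lee_fin ltW.
apply: le_lower_integral => x.
  by rewrite -EFinM lee_fin mulr_ge0 ?divr_ge0// ltW.
move: (hH x) (H0 x); case: (H x) => [r| |] //; last by move=> *; rewrite leey.
rewrite -!EFinM !lee_fin => hr _; rewrite mulrA ler_pdivrMr//.
by rewrite -ler_pdivlMl.
Qed.

(** The product form follows from the sum form: scale [f * pdf] and [g * pdf] to have supremum 1,
    bound the square of their minimum by their product, and apply AM-GM to the two integrals. *)
Lemma prekopa_leindler_nnsfun (k : R) (f g : {nnsfun measurableTypeR R >-> R})
    (H : R -> \bar R) : (0 < k)%R -> (forall x, 0 <= H x) ->
  (forall x y, (f x * g y)%:E <=
     (k * expR ((x - y) ^+ 2 / 4))%:E * (H ((x + y) / 2)%R * H ((x + y) / 2)%R)) ->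
  \int[gamma1]_x (f x)%:E * \int[gamma1]_x (g x)%:E <=
    k%:E * (\int[gamma1]_x H x * \int[gamma1]_x H x).
Proof.
move=> k0 H0 fgH.
have intH0 : 0 <= \int[gamma1]_x H x by exact: integral_ge0.
have RHS0 : 0 <= k%:E * (\int[gamma1]_x H x * \int[gamma1]_x H x).
  by rewrite !mule_ge0// lee_fin ltW.
have pdf0 x : (0 < pdf x)%R by exact: normal_pdf_gt0.
have zero (h : {nnsfun measurableTypeR R >-> R}) :
    ~ (exists x, (0 < h x)%R) -> \int[gamma1]_x (h x)%:E = 0.
  move=> nh; apply: integral0_eq => x _; apply/eqP; rewrite eqe eq_le fun_ge0 andbT.
  by rewrite leNgt; apply/negP => hx; apply: nh; exists x.
have [[x0 fx0]|/zero ->] := pselect (exists x, (0 < f x)%R); last by rewrite mul0e.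
have [[y0 gy0]|/zero ->] := pselect (exists x, (0 < g x)%R); last by rewrite mule0.
have normalize (h : {nnsfun measurableTypeR R >-> R}) z : (0 < h z)%R ->
    exists2 al : R, (0 < al)%R & let a := fun x : measurableTypeR R => (al^-1 * (h x * pdf x))%R in
    [/\ measurable_fun setT a, (forall x, 0 <= a x <= 1)%R,
      (forall s, (s < 1)%R -> exists x, (s < a x)%R) &
      \int[leb]_x (a x)%:E = (al^-1)%:E * \int[gamma1]_x (h x)%:E].
  move=> hz; have [M hM] := nnsfun_ub h.
  set S := range (fun x => h x * pdf x)%R.
  have M0 : (0 <= M)%R by rewrite (le_trans _ (hM z))// ltW.
  have S0 : has_sup S.
    split; first by exists (h z * pdf z)%R, z.
    exists (M * normal_peak 1)%R => _ [x _ <-].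
    apply: ler_pM; [exact: fun_ge0|exact: normal_pdf_ge0|exact: hM|].
    by apply: normal_pdf_ub; rewrite oner_eq0.
  have hsup x : (h x * pdf x <= sup S)%R.
    by apply: ub_le_sup; [case: S0|exists x].
  have sup0 : (0 < sup S)%R by rewrite (lt_le_trans _ (hsup z))// mulr_gt0.
  have ma : measurable_fun setT (fun x : measurableTypeR R => ((sup S)^-1 * (h x * pdf x))%R).
    apply: measurable_funM => //; apply: measurable_funM => //.
    exact: measurable_normal_pdf.
  exists (sup S) => //=; split => //.
  - move=> x; rewrite !mulr_ge0 ?invr_ge0 ?(ltW sup0) ?(ltW (pdf0 x))//=.
    by rewrite ler_pdivrMl// mulr1.
  - move=> s s1; have : (0 < sup S * (1 - s))%R by rewrite mulr_gt0// subr_gt0.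
    move=> /(sup_adherent)/(_ S0)[_ [x _ <-]] hx; exists x.
    rewrite ltr_pdivlMl//; move: hx; rewrite mulrBr mulr1 opprB addrC.
    by rewrite subrK.
  - rewrite integral_gamma1_nnsfun.
    rewrite -ge0_integralZl//; first 1 last.
    + by move=> x _; rewrite -EFinM lee_fin mulr_ge0// ltW.
    + by rewrite lee_fin invr_ge0 ltW.
    + apply/emeasurable_funM; first exact/measurable_EFinP.
      by apply/measurable_EFinP; exact: measurable_normal_pdf.
have [al al0 [ma a01 a1 inta]] := normalize _ _ fx0.
have [be be0 [mb b01 b1 intb]] := normalize _ _ gy0.
(* With this [s], the product of the normalised functions at [x] and [y] is at most the square of
   [H * pdf / s] at the midpoint: [normal_pdf_mid] cancels the exponential in the hypothesis. *)
set s := Num.sqrt (al * be / k).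
have s0 : (0 < s)%R by rewrite sqrtr_gt0 divr_gt0// mulr_gt0.
have s2 : (s ^+ 2 = al * be / k)%R by rewrite sqr_sqrtr// divr_ge0 ?mulr_ge0// ltW.
have := @prekopa_leindler_sum R _ _ (fun x => (s^-1)%:E * (H x * (pdf x)%:E))
  ma mb a01 b01 a1 b1.
have ffin := integral_nnsfun_gamma1_fin f.
have gfin := integral_nnsfun_gamma1_fin g.
rewrite inta intb.
move: ffin gfin fgH.
have f0 : 0 <= \int[gamma1]_x (f x)%:E by apply: integral_ge0 => x _; rewrite lee_fin.
have g0 : 0 <= \int[gamma1]_x (g x)%:E by apply: integral_ge0 => x _; rewrite lee_fin.
move: f0 g0.
case: (\int[gamma1]_x (f x)%:E) => [A||]// A0; case: (\int[gamma1]_x (g x)%:E) => [B||]// B0 _ _ fgH.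
rewrite -!EFinM !ltry => /(_ isT isT).
move=> PL.
have c0 x : 0 <= (s^-1)%:E * (H x * (pdf x)%:E).
  by rewrite !mule_ge0// ?lee_fin ?invr_ge0 ?normal_pdf_ge0// ltW.
have abc x y : (Num.min (al^-1 * (f x * pdf x)) (be^-1 * (g y * pdf y)))%:E <=
    (s^-1)%:E * (H ((x + y) / 2)%R * (pdf ((x + y) / 2)%R)%:E).
  set z := ((x + y) / 2)%R; move: (fgH x y) (H0 z); rewrite -/z.
  case: (H z) => [r| |] //; last first.
    by move=> *; rewrite gt0_mulye ?lte_fin// gt0_muley ?lte_fin ?invr_gt0// leey.
  rewrite -!EFinM !lee_fin => fgr r0.
  set mi := Num.min _ _.
  have mi0 : (0 <= mi)%R.
    by rewrite le_min; case/andP: (a01 x) => -> _; case/andP: (b01 y) => -> _.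
  rewrite -ler_sqr ?nnegrE//; last by rewrite !mulr_ge0 ?invr_ge0// ltW.
  apply: (@le_trans _ _ ((al^-1 * (f x * pdf x)) * (be^-1 * (g y * pdf y))))%R.
    rewrite expr2 ler_pM// ?ge_min ?lexx ?orbT//.
  rewrite !exprMn exprVn s2.
  have -> : (al^-1 * (f x * pdf x) * (be^-1 * (g y * pdf y)) =
    (al * be)^-1 * ((f x * g y) * (pdf x * pdf y)))%R by rewrite invfM; ring.
  rewrite normal_pdf_mid -/z.
  rewrite [leRHS](_ : _ = (al * be)^-1 * (k * r ^+ 2 * pdf z ^+ 2))%R; last first.
    by rewrite invf_div; ring.
  rewrite ler_pM2l ?invr_gt0 ?mulr_gt0//.
  rewrite mulrCA [leRHS]mulrC ler_pM2l ?exprn_gt0//.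
  rewrite expRN ler_pdivrMr ?expR_gt0//.
  by apply: (le_trans fgr); rewrite expr2 mulrAC.
have key := PL c0 abc.
have {}key : (al^-1 * A)%:E + (be^-1 * B)%:E <=
    2%:E * ((s^-1)%:E * \int[gamma1]_x H x).
  by apply: (le_trans key); rewrite lee_wpmul2l// lower_integral_density.
move: intH0 RHS0 key.
case: (\int[gamma1]_x H x) => [h| |] //; last first.
  by move=> *; rewrite mulyy gt0_muley ?lte_fin// leey.
rewrite -!EFinM -EFinD !lee_fin => h0 _ key2.
(* AM-GM for [A / al] and [B / be]; the scalings then cancel against [s ^+ 2]. *)
have sq : (4 * (A * B) / (al * be) <= (2 * (s^-1 * h)) ^+ 2)%R.
  apply: (@le_trans _ _ ((al^-1 * A + be^-1 * B) ^+ 2))%R; last first.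
    rewrite ler_sqr ?nnegrE// ?addr_ge0 ?mulr_ge0 ?invr_ge0 ?(ltW al0) ?(ltW be0) ?(ltW s0)//.
  rewrite -subr_ge0 (_ : _ - _ = (al^-1 * A - be^-1 * B) ^+ 2)%R ?sqr_ge0//.
  by field; rewrite !gt_eqF.
move: sq; rewrite !exprMn exprVn s2 invf_div ler_pdivrMr ?mulr_gt0//.
rewrite (_ : (2 ^+ 2 * (k / (al * be) * h ^+ 2) * (al * be) = 4 * (k * (h * h)))%R).
  by rewrite ler_pM2l.
by field; rewrite !gt_eqF.
Qed.

(** The two suprema over simple functions are taken one at a time, first below [G] with [f] fixed
    and of finite integral, then below [F]. *)
Lemma prekopa_leindler_gamma1 (k : R) (F G H : R -> \bar R) : (0 < k)%R ->
  (forall x, 0 <= F x) -> (forall x, 0 <= G x) -> (forall x, 0 <= H x) ->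
  (forall x y, F x * G y <=
     (k * expR ((x - y) ^+ 2 / 4))%:E * (H ((x + y) / 2)%R * H ((x + y) / 2)%R)) ->
  \int[gamma1]_x F x * \int[gamma1]_x G x <=
    k%:E * (\int[gamma1]_x H x * \int[gamma1]_x H x).
Proof.
move=> k0 F0 G0 H0 FGH.
have intH0 : 0 <= \int[gamma1]_x H x by exact: integral_ge0.
have RHS0 : 0 <= k%:E * (\int[gamma1]_x H x * \int[gamma1]_x H x).
  by rewrite !mule_ge0// lee_fin ltW.
move: RHS0; set c := k%:E * _ => c0.
have [cy|] := eqVneq c +oo; first by rewrite cy leey.
rewrite -ltey => cfin.
have {}cfin : c \is a fin_num by rewrite ge0_fin_numE.
have intF0 : 0 <= \int[gamma1]_x F x by exact: integral_ge0.
have intG0 : 0 <= \int[gamma1]_x G x by exact: integral_ge0.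
have step (f : {nnsfun measurableTypeR R >-> R}) : (forall x, (f x)%:E <= F x) ->
    \int[gamma1]_x (f x)%:E * \int[gamma1]_x G x <= c.
  move=> fF; have f0 : 0 <= \int[gamma1]_x (f x)%:E.
    by apply: integral_ge0 => x _; rewrite lee_fin.
  have fg (g : {nnsfun measurableTypeR R >-> R}) : (forall x, (g x)%:E <= G x) ->
      \int[gamma1]_x (f x)%:E * \int[gamma1]_x (g x)%:E <= c.
    move=> gG; apply: prekopa_leindler_nnsfun => // x y.
    by apply: le_trans (FGH x y); rewrite EFinM lee_pmul ?lee_fin.
  move: (integral_nnsfun_gamma1_fin f) f0 fg.
  case: (\int[gamma1]_x (f x)%:E) => [A||]// _; rewrite lee_fin le_eqVlt.
  case/predU1P => [<-|A0] fg; first by rewrite mul0e.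
  rewrite -lee_pdivlMl//; apply: lower_integral_le => // g gG.
  by rewrite lee_pdivlMl//; exact: fg.
move: intG0 step; case: (\int[gamma1]_x G x) => [B| |]//.
  rewrite lee_fin le_eqVlt => /predU1P[<-|B0] step; first by rewrite mule0.
  rewrite -lee_pdivlMr//; apply: lower_integral_le => // f fF.
  by rewrite lee_pdivlMr//; exact: step.
move=> _ step.
(* Here [G] has infinite integral while [c] is finite, so every simple function below [F] must
   integrate to 0. *)
suff -> : \int[gamma1]_x F x = 0 by rewrite mul0e.
apply/eqP; rewrite eq_le intF0 andbT; apply: lower_integral_le => // f fF.
have := step f fF; have f0 : 0 <= \int[gamma1]_x (f x)%:E.
  by apply: integral_ge0 => x _; rewrite lee_fin.
move: f0; rewrite le_eqVlt => /predU1P[<-//|f0].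
rewrite gt0_muley// leye_eq => /eqP cE; by move: cfin; rewrite cE.
Qed.

End prekopa_leindler_gauss.

(** * Iterated Gaussian integrals *)

Section gaussian_iterated.
Context {R : realType}.
Local Open Scope ereal_scope.

Definition upd (x : nat -> R) (k : nat) (t : R) : nat -> R :=
  fun j => if j == k then t else x j.

Lemma gauss_iterS k (F : (nat -> R) -> \bar R) x :
  gauss_iter k.+1 F x = \int[gamma1]_t gauss_iter k F (upd x k t).
Proof. by []. Qed.

Lemma gauss_iter_ge0 k (F : (nat -> R) -> \bar R) x :
  (forall y, 0 <= F y) -> 0 <= gauss_iter k F x.
Proof.
move=> F0; elim: k x => [|k IH] x; first exact: F0.
by rewrite gauss_iterS; apply: integral_ge0.
Qed.

(** The iterated integral only moves the first [k] coordinates, so the comparison may be restricted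
    to points that agree with [x] from index [k] on. *)
Lemma gauss_iter_le k (F G : (nat -> R) -> \bar R) x :
  (forall y, 0 <= F y) ->
  (forall y, (forall j, (k <= j)%N -> y j = x j) -> F y <= G y) ->
  gauss_iter k F x <= gauss_iter k G x.
Proof.
move=> F0; elim: k x => [|k IH] x FG; first exact: FG.
rewrite !gauss_iterS; apply: le_lower_integral => t; first exact: gauss_iter_ge0.
apply: IH => y yx; apply: FG => j kj; rewrite yx ?(ltnW kj)//.
by rewrite /upd gtn_eqF.
Qed.

Lemma gauss_iter_cst k (c : R) x : gauss_iter k (fun=> c%:E) x = c%:E.
Proof.
elim: k x => [//|k IH] x; rewrite gauss_iterS.
under eq_integral do rewrite IH.
have -> := integral_cst (normal_prob 0 1) (@measurableT _ (measurableTypeR R)) c%:E.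
by rewrite [X in _ * X]gamma1_setT mule1.
Qed.

(* The constant [c] absorbs the Gaussian factors of the outer coordinates in the
   induction. *)
Lemma gauss_iter_prekopa_leindler k (c : R) (F G H : (nat -> R) -> \bar R) x y :
  (0 < c)%R -> (forall s, 0 <= F s) -> (forall s, 0 <= G s) ->
  (forall s, 0 <= H s) ->
  (forall s t, (forall j, (k <= j)%N -> s j = x j) ->
    (forall j, (k <= j)%N -> t j = y j) ->
    F s * G t <= (c * expR (\sum_(j < k) (s j - t j) ^+ 2 / 4))%:E *
      (H (fun j => (s j + t j) / 2)%R * H (fun j => (s j + t j) / 2)%R)) ->
  gauss_iter k F x * gauss_iter k G y <= c%:E *
    (gauss_iter k H (fun j => (x j + y j) / 2)%R *
     gauss_iter k H (fun j => (x j + y j) / 2)%R).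
Proof.
move=> c0 F0 G0 H0; elim: k c c0 x y => [|k IH] c c0 x y FGH.
  by have := FGH x y (fun _ _ => erefl) (fun _ _ => erefl); rewrite big_ord0 expR0 mulr1.
rewrite !gauss_iterS; apply: (prekopa_leindler_gamma1 c0) => [t|t|t|s t].
- exact: gauss_iter_ge0.
- exact: gauss_iter_ge0.
- exact: gauss_iter_ge0.
have cs0 : (0 < c * expR ((s - t) ^+ 2 / 4))%R by rewrite mulr_gt0// expR_gt0.
have := IH _ cs0 (upd x k s) (upd y k t).
have -> : (fun j => (upd x k s j + upd y k t j) / 2)%R =
    upd (fun j => (x j + y j) / 2)%R k ((s + t) / 2)%R.
  by apply/funext => j; rewrite /upd; case: eqP.
apply => u v ux vy; have := FGH u v.
rewrite big_ord_recr/= (ux k) // (vy k)// /upd !eqxx addrC expRD mulrA; apply.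
- by move=> j kj; rewrite (ux j) ?(ltnW kj)// /upd gtn_eqF.
- by move=> j kj; rewrite (vy j) ?(ltnW kj)// /upd gtn_eqF.
Qed.

(** For measurable integrands, the density is even and Lebesgue measure is reflection invariant. For
    arbitrary ones, simple functions give one inequality, and applying it to the reflected function
    gives the other. *)
Lemma lower_integral_gamma1N (F : R -> \bar R) : (forall t, 0 <= F t) ->
  \int[gamma1]_t F (- t)%R = \int[gamma1]_t F t.
Proof.
move=> F0.
have meas (h : measurableTypeR R -> \bar R) : measurable_fun setT h -> (forall t, 0 <= h t) ->
    \int[gamma1]_t h (- t)%R = \int[gamma1]_t h t.
  move=> mh h0.
  have mopp : measurable_fun setT (-%R : measurableTypeR R -> measurableTypeR R).
    exact: oppr_measurable.
  have mhN : measurable_fun setT (fun t : measurableTypeR R => h (- t)%R).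
    exact: (measurableT_comp mh mopp).
  rewrite !integral_gamma1//.
  pose g (t : measurableTypeR R) := h t * (normal_pdf 0 1 t)%:E.
  have mg : measurable_fun setT g.
    apply: emeasurable_funM => //.
    by apply/measurable_EFinP; exact: measurable_normal_pdf.
  have g0 : {in [set: measurableTypeR R], forall t, 0 <= g t}.
    by move=> t _; rewrite /g mule_ge0// lee_fin normal_pdf_ge0.
  have E := @ge0_integral_pushforward _ _ _ _ R _ mopp lebesgue_measure _ _ measurableT mg g0.
  rewrite preimage_setT in E.
  transitivity (\int[lebesgue_measure]_t (g \o -%R) t).
    apply: eq_integral => t _; rewrite /g/=.
    by rewrite !normal_pdfE ?oner_eq0//= /normal_fun !subr0 sqrrN.
  rewrite -E.
  apply: eq_measure_integral => A mA _; exact: lebesgue_measureN.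
have le (G : R -> \bar R) : (forall t, 0 <= G t) -> \int[gamma1]_t G (- t)%R <= \int[gamma1]_t G t.
  move=> G0; apply: lower_integral_le => // h hG.
  rewrite -(meas (EFin \o h)); last 2 first.
  - exact/measurable_EFinP.
  - by move=> t; rewrite lee_fin.
  apply: le_lower_integral => t; first by rewrite lee_fin.
  by have := hG (- t)%R; rewrite /= opprK.
apply/eqP; rewrite eq_le le//=.
have := le (fun t => F (- t)%R) (fun t => F0 (- t)%R).
by under eq_integral do rewrite opprK.
Qed.

Lemma integral_gamma1N (F : R -> \bar R) :
  \int[gamma1]_t F (- t)%R = \int[gamma1]_t F t.
Proof.
rewrite integralE [in RHS]integralE.
congr (_ - _).
- rewrite -[RHS]lower_integral_gamma1N; last by move=> t; exact: funepos_ge0.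
  by apply: eq_integral => t _; rewrite !funeposE.
- rewrite -[RHS]lower_integral_gamma1N; last by move=> t; exact: funeneg_ge0.
  by apply: eq_integral => t _; rewrite !funenegE.
Qed.

Lemma gauss_iterN k (F : (nat -> R) -> \bar R) x :
  gauss_iter k (fun y => F (fun j => - y j)%R) x = gauss_iter k F (fun j => - x j)%R.
Proof.
elim: k x => [//|k IH] x; rewrite !gauss_iterS.
rewrite -[in RHS]integral_gamma1N; apply: eq_integral => t _.
rewrite IH; congr (gauss_iter _ _ _); apply/funext => j.
by rewrite /upd; case: eqP.
Qed.

End gaussian_iterated.

(** * Iterated integrals of bounded continuous functions *)

Section nice_functions.
Context {R : realType}.
Implicit Types (f g : (nat -> R) -> R) (x : nat -> R).

(* Sequential continuity is what dominated convergence propagates through partial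
   integration; it avoids putting a topology on [nat -> R]. *)
Definition seq_continuous f := forall (s : nat -> nat -> R) x,
  (forall j, s ^~ j @ \oo --> x j) -> (fun m => f (s m)) @ \oo --> f x.

Definition bounded_by (M : R) f := forall x, `|f x| <= M.

Lemma seq_continuous_line f x k :
  seq_continuous f -> continuous (fun t => f (upd x k t)).
Proof.
move=> cf t.
apply: (@cvg_nbhsP R R^o (fun t => f (upd x k t)) t (f (upd x k t))).2 => u ut; apply: cf => j.
rewrite /upd; case: eqP => // _; exact: cvg_cst.
Qed.

(** Integrating out a coordinate stays in the class: continuity along lines gives measurability, and
    dominated convergence with the constant [M], integrable for a probability measure, returns
    sequential continuity. *)
Lemma gauss_iter_fin k f M : 0 <= M -> seq_continuous f -> bounded_by M f ->
  exists g, [/\ seq_continuous g, bounded_by M g &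
    forall x, gauss_iter k (EFin \o f) x = (g x)%:E].
Proof.
move=> M0 cf bf; elim: k => [|k [g [cg bg fg]]]; first by exists f.
have mg x : measurable_fun setT (fun t : measurableTypeR R => (g (upd x k t))%:E).
  apply/measurable_EFinP; apply: continuous_measurable_fun.
  exact: seq_continuous_line.
have icM : (normal_prob 0 1).-integrable setT (cst M%:E : measurableTypeR R -> \bar R).
  exact: finite_measure_integrable_cst.
have ig x : (normal_prob 0 1).-integrable setT (fun t : measurableTypeR R => (g (upd x k t))%:E).
  apply: (le_integrable _ _ _ icM) => //= t _.
  by rewrite lee_fin (le_trans (bg _))// ler_norm.
pose G x := fine (\int[gamma1]_t (g (upd x k t))%:E).
have GE x : (\int[gamma1]_t (g (upd x k t))%:E = (G x)%:E)%E.
  by rewrite /G fineK//; exact: integrable_fin_num (ig x).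
exists G; split.
- move=> s x sx.
  have H : (fun m => (G (s m))%:E) @ \oo --> (G x)%:E.
    under eq_fun do rewrite -GE.
    rewrite -GE; apply: (@dominated_cvg _ _ _ _ _ _ _ _ (cst M%:E)) => //.
    + move=> t _; apply: cvg_EFin; first exact: nearW.
      apply: cg => j; rewrite /upd; case: eqP => // _; exact: cvg_cst.
    + by move=> m t _ /=; rewrite lee_fin.
  by move/fine_cvg: H.
- move=> x; rewrite -lee_fin -abse_EFin -GE.
  apply: (le_trans (le_abse_integral _ _ _)) => //.
  apply: (@le_trans _ _ (\int[gamma1]_t (cst M%:E t : \bar R))%E).
    by apply: le_lower_integral => t /=; rewrite lee_fin.
  have -> := integral_cst (normal_prob 0 1) (@measurableT _ (measurableTypeR R)) M%:E.
  by rewrite [X in (_ * X)%E]gamma1_setT mule1.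
- move=> x; rewrite -GE gauss_iterS; apply: eq_integral => t _.
  exact: fg.
Qed.

Lemma gauss_iter_linear k f g M N (a : R) x : 0 <= M -> 0 <= N ->
  seq_continuous f -> bounded_by M f -> seq_continuous g -> bounded_by N g ->
  gauss_iter k (EFin \o (fun y => a * f y + g y)) x =
  (a%:E * gauss_iter k (EFin \o f) x + gauss_iter k (EFin \o g) x)%E.
Proof.
move=> M0 N0 cf bf cg bg; elim: k x => [|k IH] x; first by rewrite /= EFinD EFinM.
rewrite !gauss_iterS.
have [f' [cf' bf' ff']] := gauss_iter_fin k M0 cf bf.
have [g' [cg' bg' gg']] := gauss_iter_fin k N0 cg bg.
have int h L : 0 <= L -> seq_continuous h -> bounded_by L h ->
    (normal_prob 0 1).-integrable setT (fun t : measurableTypeR R => (h (upd x k t))%:E).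
  move=> L0 ch bh.
  have icL : (normal_prob 0 1).-integrable setT (cst L%:E : measurableTypeR R -> \bar R).
    exact: finite_measure_integrable_cst.
  apply: (le_integrable _ _ _ icL) => //=.
    apply/measurable_EFinP; apply: continuous_measurable_fun.
    exact: seq_continuous_line.
  by move=> t _; rewrite lee_fin (le_trans (bh _))// ler_norm.
have intf := int _ _ M0 cf' bf'; have intg := int _ _ N0 cg' bg'.
under eq_integral do rewrite IH ff' gg'.
under [in X in (_ * X)%E]eq_integral do rewrite ff'.
under [in X in (_ + X)%E]eq_integral do rewrite gg'.
rewrite integralD//; last exact: integrableZl.
by rewrite integralZl.
Qed.

End nice_functions.

(** * The Gaussian integral on row vectors *)

Section gaussian_functional.
Context {R : realType} {n : nat}.
Implicit Types (f g : 'rV[R]_n -> R).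

Definition mid (x y : 'rV[R]_n) : 'rV[R]_n := 2^-1 *: (x + y).

Lemma gauss_int_ge0 (F : 'rV[R]_n -> \bar R) :
  (forall x, 0 <= F x)%E -> (0 <= gauss_int F)%E.
Proof. by move=> F0; apply: gauss_iter_ge0. Qed.

Lemma gauss_int_le (F G : 'rV[R]_n -> \bar R) :
  (forall x, 0 <= F x)%E -> (forall x, F x <= G x)%E ->
  (gauss_int F <= gauss_int G)%E.
Proof. by move=> F0 FG; apply: gauss_iter_le. Qed.

Lemma gauss_int_prekopa_leindler (F G H : 'rV[R]_n -> \bar R) :
  (forall x, 0 <= F x)%E -> (forall x, 0 <= G x)%E -> (forall x, 0 <= H x)%E ->
  (forall x y, F x * G y <=
    (expR (eucl_norm2 (x - y) / 4))%:E * (H (mid x y) * H (mid x y)))%E ->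
  (gauss_int F * gauss_int G <= gauss_int H * gauss_int H)%E.
Proof.
move=> F0 G0 H0 FGH.
have := @gauss_iter_prekopa_leindler R n 1 (fun x => F (\row_i x i))
  (fun x => G (\row_i x i)) (fun x => H (\row_i x i)) (fun=> 0) (fun=> 0) ltr01.
rewrite (_ : (fun j => (0 + 0) / 2) = fun=> 0 :> R); last first.
  by apply/funext => j; rewrite addr0 mul0r.
rewrite mul1e; apply => //= s t _ _.
have := FGH (\row_i s i) (\row_i t i).
rewrite (_ : mid _ _ = \row_i ((s i + t i) / 2)); last first.
  by apply/rowP => i; rewrite !mxE mulrC.
suff -> : \sum_(i < n) (s i - t i) ^+ 2 / 4 =
    eucl_norm2 (\row_(i < n) s i - \row_(i < n) t i) / 4.
  by rewrite mul1r.
by rewrite /eucl_norm2 mulr_suml; apply: eq_bigr => i _; rewrite !mxE.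
Qed.

Lemma cvg_row (s : nat -> nat -> R) (x : nat -> R) :
  (forall j, s ^~ j @ \oo --> x j) ->
  (fun m => \row_(i < n) s m i : 'rV[R]_n) @ \oo --> (\row_(i < n) x i : 'rV[R]_n).
Proof.
move=> sx; apply/cvgrPdist_lt => e e0.
have : \forall m \near \oo, forall i : 'I_n, `|x i - s m i| < e.
  by apply: filter_forall => i; have /cvgrPdist_lt := sx i; apply.
apply: filterS => m H; rewrite /Num.norm/= mx_normrE.
apply/bigmax_ltP; split=> // -[i j] _ /=.
by rewrite !mxE; exact: H.
Qed.

(** The class on which [gauss_int] is real-valued and linear. *)
Definition nice f := continuous f /\ exists2 M, 0 <= M & forall x, `|f x| <= M.

(** [fine] would send an infinite value to 0; by [gauss_int_nice] nothing is lost on nice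
    functions. *)
Definition gint f : R := fine (gauss_int (EFin \o f)).

Lemma seq_continuous_row f : continuous f ->
  seq_continuous (fun x => f (\row_i x i)).
Proof.
move=> cf s x sx; apply: (cvg_comp (fun m => \row_(i < n) s m i) f (cvg_row sx)).
exact: cf.
Qed.

Lemma gauss_int_nice f : nice f -> gauss_int (EFin \o f) = (gint f)%:E.
Proof.
move=> [cf [M M0 fM]].
have [g [_ _ gE]] := @gauss_iter_fin R n _ M M0 (seq_continuous_row cf) (fun x => fM _).
by rewrite /gint /gauss_int /comp/= -/(EFin \o _) gE.
Qed.

Lemma continuous_linear (a : R) f g : continuous f -> continuous g ->
  continuous (fun x => a * f x + g x).
Proof. by move=> cf cg x; exact: (cvgD (cvgM (cvg_cst a) (cf x)) (cg x)). Qed.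

Lemma nice_linear (a : R) f g : nice f -> nice g -> nice (fun x => a * f x + g x).
Proof.
move=> [cf [M M0 fM]] [cg [N N0 gN]]; split.
  exact: continuous_linear.
exists (`|a| * M + N); first by rewrite addr_ge0// mulr_ge0.
by move=> x; rewrite (le_trans (ler_normD _ _))// lerD// normrM ler_wpM2l.
Qed.

Lemma gint_linear (a : R) f g : nice f -> nice g ->
  gint (fun x => a * f x + g x) = a * gint f + gint g.
Proof.
move=> nf ng; apply/EFin_inj.
rewrite -(gauss_int_nice (nice_linear a nf ng)) EFinD EFinM -!gauss_int_nice//.
case: nf => [cf [M M0 fM]]; case: ng => [cg [N N0 gN]].
exact: (gauss_iter_linear _ _ _ M0 N0 (seq_continuous_row cf) (fun x => fM _)
  (seq_continuous_row cg) (fun x => gN _)).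
Qed.

Lemma nice0 : nice (fun=> 0).
Proof. by split; [exact: cst_continuous|exists 0 => // x; rewrite normr0]. Qed.

Lemma gint0 : gint (fun=> 0) = 0.
Proof. by rewrite /gint /gauss_int/= gauss_iter_cst. Qed.

Lemma nice_sum (I : Type) (r : seq I) (F : I -> 'rV[R]_n -> R) :
  (forall i, nice (F i)) -> nice (fun x => \sum_(i <- r) F i x).
Proof.
move=> nF; elim: r => [|i r IH].
  by under eq_fun do rewrite big_nil; exact: nice0.
under eq_fun do rewrite big_cons -[F i _]mul1r.
exact: nice_linear.
Qed.

Lemma gint_sum (I : Type) (r : seq I) (F : I -> 'rV[R]_n -> R) :
  (forall i, nice (F i)) ->
  gint (fun x => \sum_(i <- r) F i x) = \sum_(i <- r) gint (F i).
Proof.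
move=> nF; elim: r => [|i r IH].
  by under eq_fun do rewrite big_nil; rewrite gint0 big_nil.
under eq_fun do rewrite big_cons -[F i _]mul1r.
by rewrite gint_linear// ?mul1r ?IH ?big_cons//; exact: nice_sum.
Qed.

Lemma gint_ge0 f : (forall x, 0 <= f x) -> 0 <= gint f.
Proof. by move=> f0; rewrite fine_ge0// gauss_int_ge0// => x; rewrite lee_fin. Qed.

Lemma gint_le f g : nice f -> nice g -> (forall x, f x <= g x) -> gint f <= gint g.
Proof.
move=> nf ng fg; rewrite -subr_ge0 addrC -mulN1r -gint_linear//.
by apply: gint_ge0 => x; rewrite mulN1r addrC subr_ge0.
Qed.

Lemma gint_odd f : nice f -> (forall x, f (- x) = - f x) -> gint f = 0.
Proof.
move=> nf fN; suff : gint f = -1 * gint f + gint (fun=> 0).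
  by rewrite gint0 addr0 mulN1r; lra.
rewrite -gint_linear//; last exact: nice0.
rewrite /gint /gauss_int/=; congr fine.
have := @gauss_iterN R n (fun y => (f (\row_i y i))%:E) (fun=> 0).
rewrite (_ : (fun j : nat => - 0) = fun=> 0 :> R); last by apply/funext => j; rewrite oppr0.
move=> <-; congr (gauss_iter _ _ _); apply/funext => y; congr EFin.
by rewrite addr0 mulN1r -fN; congr f; apply/rowP => i; rewrite !mxE.
Qed.

End gaussian_functional.

(** * Poincare inequality for odd functions *)

Section poincare.
Context {R : realType} {n : nat}.
Implicit Types (f h q psi : 'rV[R]_n -> R) (x y : 'rV[R]_n).

Lemma compact_norm_le (M : R) : compact [set x : 'rV[R]_n | `|x| <= M].
Proof.
apply: bounded_closed_compact.
  by exists M; split; [exact: num_real|move=> r Mr x /= /le_trans; apply; exact: ltW].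
rewrite (_ : [set _ | _] = (fun x : 'rV[R]_n => `|x|) @^-1` [set r | r <= M])//.
by apply: closed_comp; [move=> x _; exact: norm_continuous|exact: closed_le].
Qed.

Lemma continuous_bounded_ball f (M : R) : continuous f ->
  exists2 C, 0 <= C & forall x, `|x| <= M -> `|f x| <= C.
Proof.
move=> cf; have [M0|M0] := ltP M 0.
  by exists 0 => // x; rewrite leNgt (lt_le_trans M0).
have ne : [set x : 'rV[R]_n | `|x| <= M] !=set0 by exists 0; rewrite /= normr0.
have cN : {within [set x : 'rV[R]_n | `|x| <= M], continuous (fun x => `|f x|)}.
  apply: continuous_subspaceT => x.
  exact: cvg_norm (cf x).
have [c _ fc] := EVT_max_rV ne (@compact_norm_le M) cN.
by exists `|f c| => // x xM; apply: fc; rewrite inE.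
Qed.

(** Heine-Cantor: on the compact set of pairs where [f] differs by at least [e], the distance
    attains a positive minimum, taken as [eta]. *)
Lemma continuous_uniform_ball f (M e : R) : continuous f -> 0 < e ->
  exists2 eta, 0 < eta & forall x y, `|x| <= M -> `|y| <= M ->
    `|x - y| < eta -> `|f x - f y| < e.
Proof.
move=> cf e0.
set B := [set x : 'rV[R]_n | `|x| <= M].
pose F (p : 'rV[R]_n * 'rV[R]_n) := `|f p.1 - f p.2|.
pose D (p : 'rV[R]_n * 'rV[R]_n) := `|p.1 - p.2|.
have cF : continuous F.
  move=> p; apply: (cvg_comp (fun p : 'rV[R]_n * 'rV[R]_n => f p.1 - f p.2)
    (fun r => `|r|)); last exact: norm_continuous.
  apply: cvgB.
    exact: (cvg_comp fst f cvg_fst (cf _)).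
  exact: (cvg_comp snd f cvg_snd (cf _)).
have cD : continuous D.
  move=> p; apply: (cvg_comp (fun p : 'rV[R]_n * 'rV[R]_n => p.1 - p.2)
    (fun r => `|r|)); last exact: norm_continuous.
  by apply: cvgB; [exact: cvg_fst|exact: cvg_snd].
have cA : compact ((B `*` B) `&` [set p | e <= F p]).
  apply: compact_closedI; first by apply: compact_setX; exact: compact_norm_le.
  rewrite (_ : [set p | _] = F @^-1` [set r | e <= r])//.
  by apply: closed_comp; [move=> p _; exact: cF|exact: closed_ge].
have [A0|/set0P A0] := eqVneq ((B `*` B) `&` [set p | e <= F p]) set0.
  exists 1 => // x y xM yM _; rewrite ltNge; apply/negP => exy.
  have : ((B `*` B) `&` [set p | e <= F p]) (x, y) by [].
  by rewrite A0.
have [[c1 c2] /set_mem [_ /= ec] Dc] := compact_EVT_min A0 cA (continuous_subspaceT cD).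
exists (D (c1, c2)).
  rewrite normr_gt0 subr_eq0; apply/eqP => /= c12; move: ec.
  by rewrite /F/= c12 subrr normr0 leNgt e0.
move=> x y xM yM xy; rewrite ltNge; apply/negP => exy.
by have := Dc (x, y); rewrite inE => /(_ (conj (conj xM yM) exy)); rewrite leNgt xy.
Qed.

(** The norm on row vectors is the maximum norm, so its square is one of the terms of the sum. *)
Lemma norm_le_eucl x : `|x| ^+ 2 <= eucl_norm2 x.
Proof.
have [x0|x0] := eqVneq `|x| 0.
  by rewrite x0 expr0n/= sumr_ge0// => i _; exact: sqr_ge0.
have [[i j] xij] := mx_norm_neq0 x0.
rewrite {1}/Num.norm/= xij (ord1 i)/= real_normK ?num_real// /eucl_norm2 (bigD1 j)//=.
by rewrite lerDl sumr_ge0// => k _; exact: sqr_ge0.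
Qed.

Lemma norm_segment_le (M t : R) x y : 0 <= t <= 1 -> `|x| <= M -> `|y| <= M ->
  `|y + t *: (x - y)| <= M.
Proof.
move=> /andP[t0 t1] xM yM.
rewrite (_ : _ + _ = t *: x + (1 - t) *: y); last first.
  by rewrite scalerBr scalerBl scale1r addrCA addrC.
rewrite (le_trans (ler_normD _ _))// !normrZ !ger0_norm ?subr_ge0//.
rewrite -[leRHS](_ : t * M + (1 - t) * M = M); last by ring.
by apply: lerD; rewrite ler_wpM2l ?subr_ge0.
Qed.

(* The linearised Prekopa-Leindler condition at two points [x], [y] with
   [D = |x - y|^2]: here [qz] bounds the squared slope of [h] between [x] and [y]
   and is close to [qx]; [perturbation_far] handles distant points, where [D / 4]
   dominates everything of order [e]. *)
Lemma perturbation_near (e d C hx hy qx qz D : R) : 0 < e -> 0 < d -> 0 <= C ->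
  0 <= D -> `|hx| <= C -> `|hy| <= C -> 0 <= qx <= C -> 0 <= qz ->
  (hx - hy) ^+ 2 <= qz * D -> qz <= qx + d / 3 -> C * `|hx - hy| <= d / 3 ->
  e * (C ^+ 3 + (C + d) * C) <= d / 3 ->
  (1 + e * hx + e ^+ 2 * (hx ^+ 2 - qx - d)) * (1 - e * hy) <= 1 + D / 4.
Proof.
move=> e0 d0 C0 D0 hxC hyC /andP[qx0 qxC] qz0 hq qq hh ee.
have a0 : 0 <= e ^+ 2 * qz + D / 4.
  by apply: addr_ge0; [apply: mulr_ge0; [exact: sqr_ge0|]|apply: divr_ge0].
(* AM-GM: [e a <= e^2 q + D / 4] as soon as [a^2 <= q D] *)
have st : e * (hx - hy) <= e ^+ 2 * qz + D / 4.
  have [neg|pos] := leP (hx - hy) 0.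
    by apply: (le_trans _ a0); rewrite mulr_ge0_le0// ltW.
  rewrite -ler_sqr ?nnegrE//; last by rewrite mulr_ge0// ltW.
  apply: (@le_trans _ _ (e ^+ 2 * (qz * D))).
    by rewrite exprMn ler_wpM2l// sqr_ge0.
  rewrite -subr_ge0 (_ : _ - _ = (e ^+ 2 * qz - D / 4) ^+ 2) ?sqr_ge0//.
  by field.
have ss : e ^+ 2 * (hx * (hx - hy)) <= e ^+ 2 * (d / 3).
  rewrite ler_wpM2l ?sqr_ge0//; apply: le_trans hh.
  by rewrite (le_trans (ler_norm _))// normrM ler_wpM2r.
have rr : e ^+ 3 * (- (hx ^+ 2 * hy) + (qx + d) * hy) <= e ^+ 2 * (d / 3).
  rewrite exprSr -mulrA ler_wpM2l ?sqr_ge0//.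
  apply: le_trans ee; rewrite ler_wpM2l ?(ltW e0)//.
  apply: (le_trans (ler_norm _)); apply: (le_trans (ler_normD _ _)).
  apply: lerD.
    by rewrite normrN normrM normrX [C ^+ 3]exprSr ler_pM ?exprn_ge0// lerXn2r ?nnegrE.
  rewrite normrM ler_pM// ger0_norm; last by rewrite addr_ge0// ltW.
  by rewrite lerD2r.
have qq2 : e ^+ 2 * qz <= e ^+ 2 * (qx + d / 3) by rewrite ler_wpM2l// sqr_ge0.
have -> : (1 + e * hx + e ^+ 2 * (hx ^+ 2 - qx - d)) * (1 - e * hy) =
  1 - e ^+ 2 * (qx + d) + e * (hx - hy) + e ^+ 2 * (hx * (hx - hy)) +
  e ^+ 3 * (- (hx ^+ 2 * hy) + (qx + d) * hy) by ring.
lra.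
Qed.

Lemma perturbation_far (e d C hx hy qx D : R) : 0 < e <= 1 -> 0 < d -> 0 <= C ->
  `|hx| <= C -> `|hy| <= C -> 0 <= qx <= C ->
  e * (2 * C + 2 * C ^+ 2 + C ^+ 3 + (C + d) * C) <= D / 4 ->
  (1 + e * hx + e ^+ 2 * (hx ^+ 2 - qx - d)) * (1 - e * hy) <= 1 + D / 4.
Proof.
move=> /andP[e0 e1] d0 C0 hxC hyC /andP[qx0 qxC] eD.
(* Since [e <= 1], all higher-order terms can be charged to order one. *)
have small (k : nat) (X Y : R) : X <= Y -> 0 <= Y -> e ^+ k.+1 * X <= e * Y.
  move=> XY Y0; apply: (@le_trans _ _ (e ^+ k.+1 * Y)).
    by rewrite ler_wpM2l// exprn_ge0// ltW.
  by rewrite ler_wpM2r// exprS ler_piMr ?exprn_ile1// ltW.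
have h1 : e * (hx - hy) <= e * (2 * C).
  rewrite ler_wpM2l ?(ltW e0)// (le_trans (ler_norm _))//.
  by rewrite (le_trans (ler_normB _ _))// mulr_natl mulr2n lerD.
have h2 : e ^+ 2 * (hx ^+ 2 - hx * hy - (qx + d)) <= e * (2 * C ^+ 2).
  apply: small; last by rewrite mulr_ge0// exprn_ge0.
  have : hx ^+ 2 - hx * hy <= 2 * C ^+ 2.
    rewrite (le_trans (ler_norm _))// (le_trans (ler_normB _ _))//.
    rewrite normrX [`|hx * hy|]normrM [leRHS]mulr_natl mulr2n lerD//.
      by rewrite lerXn2r ?nnegrE.
    by rewrite expr2 ler_pM.
  by lra.
have h3 : e ^+ 3 * (- (hx ^+ 2 * hy)) <= e * C ^+ 3.
  apply: small; last by rewrite exprn_ge0.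
  rewrite (le_trans (ler_norm _))//.
  by rewrite normrN normrM normrX [C ^+ 3]exprSr ler_pM ?exprn_ge0// lerXn2r ?nnegrE.
have h4 : e ^+ 3 * ((qx + d) * hy) <= e * ((C + d) * C).
  apply: small; last by rewrite mulr_ge0// addr_ge0// ltW.
  rewrite (le_trans (ler_norm _))// normrM ler_pM// ger0_norm ?lerD2r//.
  by rewrite addr_ge0// ltW.
have -> : (1 + e * hx + e ^+ 2 * (hx ^+ 2 - qx - d)) * (1 - e * hy) =
  1 + e * (hx - hy) + e ^+ 2 * (hx ^+ 2 - hx * hy - (qx + d)) +
  e ^+ 3 * (- (hx ^+ 2 * hy)) + e ^+ 3 * ((qx + d) * hy) by ring.
lra.
Qed.

Lemma nice_cutoff f psi (M : R) : continuous f -> continuous psi ->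
  (forall x, 0 <= psi x <= 1) -> (forall x, 0 < psi x -> `|x| <= M) ->
  nice (fun x => f x * psi x).
Proof.
move=> cf cpsi psi01 psiM; split.
  by move=> x; exact: (cvgM (cf x) (cpsi x)).
have [C C0 fC] := continuous_bounded_ball M cf.
exists C => // x; have /andP[p0 p1] := psi01 x.
move: p0; rewrite le_eqVlt => /predU1P[<-|p0]; first by rewrite mulr0 normr0.
rewrite normrM (ger0_norm (ltW p0)) -[leRHS]mulr1 ler_pM//; first exact: ltW.
exact/fC/psiM.
Qed.

(** [q] stands for the squared gradient of [h] and enters through the mean value inequality alone.
    Writing [I] for the mass of [psi] and [X], [Y] for the two integrals, Prekopa-Leindler yields
    [(I + e ^+ 2 * (X - Y - d * I)) * I <= I * I]. *)
Lemma poincare_odd (psi h q : 'rV[R]_n -> R) (M : R) :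
  continuous psi -> (forall x, 0 <= psi x <= 1) ->
  (forall x, psi (- x) = psi x) -> (forall x, 0 < psi x -> `|x| <= M) ->
  (forall x y, psi x * psi y <= psi (mid x y) ^+ 2) -> 0 < gint psi ->
  continuous h -> (forall x, h (- x) = - h x) ->
  continuous q -> (forall x, 0 <= q x) ->
  (forall x y, exists2 t, 0 <= t <= 1 &
     (h x - h y) ^+ 2 <= q (y + t *: (x - y)) * eucl_norm2 (x - y)) ->
  gint (fun x => h x ^+ 2 * psi x) <= gint (fun x => q x * psi x).
Proof.
move=> cpsi psi01 psiN psiM psimid psigt0 ch hN cq q0 hq.
have psi0 x : 0 <= psi x by case/andP: (psi01 x).
have npsi : nice psi.
  have : nice (fun x => 1 * psi x).
    apply: nice_cutoff psiM => //; exact: cst_continuous.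
  by under eq_fun do rewrite mul1r.
have cut f : continuous f -> nice (fun x => f x * psi x).
  by move=> cf; exact: nice_cutoff psiM.
have ch2 : continuous (fun x => h x ^+ 2).
  by move=> x; exact: (cvgM (ch x) (ch x)).
suff main d : 0 < d ->
    gint (fun x => h x ^+ 2 * psi x) - gint (fun x => q x * psi x) <= d * gint psi.
  rewrite -subr_le0 leNgt; apply/negP => pos.
  (* For this [d] the right-hand side is half of the supposedly positive left-hand side. *)
  have := main ((gint (fun x => h x ^+ 2 * psi x) - gint (fun x => q x * psi x)) / (2 * gint psi)).
  rewrite divr_gt0 ?mulr_gt0// => /(_ isT).
  rewrite invfM mulrA mulfVK ?gt_eqF// => ?; lra.
move=> d0.
have [Ch Ch0 hCh] := continuous_bounded_ball M ch.
have [Cq Cq0 qCq] := continuous_bounded_ball M cq.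
pose C := Ch + Cq.
have C0 : 0 <= C by rewrite addr_ge0.
have hC x : `|x| <= M -> `|h x| <= C.
  by move=> xM; rewrite (le_trans (hCh _ xM))// lerDl.
have qC x : `|x| <= M -> 0 <= q x <= C.
  move=> xM; rewrite q0/= (le_trans (ler_norm _))//.
  by rewrite (le_trans (qCq _ xM))// lerDr.
have d30 : 0 < d / 3 by rewrite divr_gt0.
have [e1 e10 qe1] := continuous_uniform_ball M cq d30.
(* The [+ 1] keeps the divisor positive when [C = 0]. *)
have d3C : 0 < d / 3 / (C + 1) by rewrite divr_gt0// ltr_wpDl.
have [e2 e20 he2] := continuous_uniform_ball M ch d3C.
pose eta := Num.min e1 e2.
have eta0 : 0 < eta by rewrite lt_min e10.
pose S1 := C ^+ 3 + (C + d) * C.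
pose S2 := 2 * C + 2 * C ^+ 2 + C ^+ 3 + (C + d) * C.
have CdC0 : 0 <= (C + d) * C by rewrite mulr_ge0// addr_ge0// ltW.
have S10 : 0 <= S1 by rewrite addr_ge0// exprn_ge0.
have S20 : 0 <= S2.
  by rewrite addr_ge0// addr_ge0 ?exprn_ge0// addr_ge0 ?mulr_ge0 ?exprn_ge0.
pose S := 1 + (2 * C + d) + S1 + S2.
have S3 : 0 <= 2 * C + d by rewrite addr_ge0 ?mulr_ge0// ltW.
have Sge1 : 1 <= S by rewrite /S; lra.
have Sgt0 : 0 < S by rewrite (lt_le_trans _ Sge1).
(* [S] dominates every constant that [e] has to beat, so [e = m / S] meets all conditions at once:
   the bound 1 serves [e <= 1] and the positivity of [A] and [B], [d / 3] the near case, and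
   [eta ^+ 2 / 4] the far case. *)
pose m := Num.min 1 (Num.min (d / 3) (eta ^+ 2 / 4)).
have m0 : 0 < m by rewrite !lt_min ltr01 d30 divr_gt0// exprn_gt0.
pose e := m / S.
have e0 : 0 < e by rewrite divr_gt0.
have eS X : 0 <= X -> X <= S -> e * X <= m.
  by move=> X0 XS; rewrite /e -mulrA ler_piMr ?(ltW m0)// ler_pdivrMl// mulr1.
have e_le1 : e <= 1.
  by have := eS 1 ler01 Sge1; rewrite mulr1 => /le_trans; apply; rewrite ge_min lexx.
have eS1 : e * S1 <= d / 3.
  apply: (le_trans (eS _ S10 _)); first by rewrite /S; lra.
  by rewrite !ge_min lexx !orbT.
have eS2 : e * S2 <= eta ^+ 2 / 4.
  apply: (le_trans (eS _ S20 _)); first by rewrite /S; lra.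
  by rewrite !ge_min lexx !orbT.
have eS3 : e * (2 * C + d) <= 1.
  apply: (le_trans (eS _ S3 _)); first by rewrite /S; lra.
  by rewrite !ge_min lexx.
pose A x := 1 + e * h x + e ^+ 2 * (h x ^+ 2 - q x - d).
pose B x := 1 - e * h x.
have eh x : `|x| <= M -> e * `|h x| <= e * C.
  by move=> xM; rewrite ler_wpM2l ?(ltW e0)// hC.
have A0 x : `|x| <= M -> 0 <= A x.
  move=> xM; have /andP[_ qxC] := qC _ xM.
  have h1 : - (e * C) <= e * h x.
    by have := eh _ xM; rewrite -[X in X * `|_|]ger0_norm ?(ltW e0)// -normrM ler_norml => /andP[].
  have h2 : e ^+ 2 * (C + d) <= e * (C + d).
    rewrite ler_wpM2r ?addr_ge0 ?(ltW d0)// expr2 ler_piMr// ltW//.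
  have h3 : - (e ^+ 2 * (C + d)) <= e ^+ 2 * (h x ^+ 2 - q x - d).
    rewrite -mulrN ler_wpM2l ?sqr_ge0//; have := sqr_ge0 (h x); lra.
  rewrite /A; lra.
have B0 x : `|x| <= M -> 0 <= B x.
  move=> xM; have h1 : e * h x <= e * C.
    by have := eh _ xM; rewrite -[X in X * `|_|]ger0_norm ?(ltW e0)// -normrM ler_norml => /andP[].
  have : 0 <= e * (C + d) by rewrite mulr_ge0 ?addr_ge0 ?(ltW e0) ?(ltW d0).
  rewrite /B; lra.
have cA : continuous A.
  rewrite (_ : A = fun x => e * h x + (e ^+ 2 * (h x ^+ 2) +
      ((- e ^+ 2) * q x + (1 - e ^+ 2 * d)))); last first.
    by apply/funext => x; rewrite /A; ring.
  apply: continuous_linear => //; apply: continuous_linear => //.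
  by apply: continuous_linear => //; exact: cst_continuous.
have cB : continuous B.
  rewrite (_ : B = fun x => (- e) * h x + 1); last first.
    by apply/funext => x; rewrite /B; ring.
  by apply: continuous_linear => //; exact: cst_continuous.
have AB x y : `|x| <= M -> `|y| <= M -> A x * B y <= expR (eucl_norm2 (x - y) / 4).
  (* The tangent bound for the exponential leaves a polynomial inequality, treated separately for
     points closer than [eta] and for the others. *)
  move=> xM yM; apply: le_trans (expR_ge1Dx _).
  have D0 : 0 <= eucl_norm2 (x - y) by apply: sumr_ge0 => i _; exact: sqr_ge0.
  have [xy|xy] := ltP `|x - y| eta.
    have [t t01 hxy] := hq x y.
    have zM := norm_segment_le t01 xM yM.
    apply: (@perturbation_near e d C (h x) (h y) (q x) (q (y + t *: (x - y)))) => //.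
    - exact: hC.
    - exact: hC.
    - exact: qC.
    - rewrite -lerBlDl (le_trans (ler_norm _))// ltW// qe1//.
      rewrite (_ : _ - _ = (t - 1) *: (x - y)); last first.
        by apply/rowP => i; rewrite !mxE; ring.
      rewrite normrZ (@le_lt_trans _ _ `|x - y|)//; last first.
        by rewrite (lt_le_trans xy)// ge_min lexx.
      rewrite ler_piMl// distrC ger0_norm; first by case/andP: t01 => t0 _; lra.
      by case/andP: t01 => _ t1; lra.
    - have : `|h x - h y| <= d / 3 / (C + 1).
        by apply/ltW/he2 => //; rewrite (lt_le_trans xy)// ge_min lexx orbT.
      rewrite ler_pdivlMr ?ltr_wpDl// => hC1; apply: le_trans hC1.
      by rewrite mulrDr mulr1 mulrC lerDl.
  apply: (@perturbation_far e d C (h x) (h y) (q x)) => //.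
  - by rewrite e0.
  - exact: hC.
  - exact: hC.
  - exact: qC.
  - apply: (le_trans eS2); rewrite ler_wpM2r// (le_trans _ (norm_le_eucl _))//.
    by rewrite lerXn2r ?nnegrE ?(ltW eta0).
have PL := @gauss_int_prekopa_leindler R n (EFin \o (fun x => A x * psi x))
  (EFin \o (fun x => B x * psi x)) (EFin \o psi).
have Fge0 (f : 'rV[R]_n -> R) : (forall x, `|x| <= M -> 0 <= f x) -> 
    forall x, (0 <= (EFin \o (fun x => (f x * psi x)%R)) x)%E.
  move=> f0 x; rewrite lee_fin; move: (psi0 x); rewrite le_eqVlt => /predU1P[<-|p0].
    by rewrite mulr0.
  by rewrite mulr_ge0 ?(ltW p0)// f0// psiM.
have FGH x y : ((EFin \o (fun x => (A x * psi x)%R)) x *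
     (EFin \o (fun x => (B x * psi x)%R)) y <=
    (expR (eucl_norm2 (x - y) / 4))%:E * ((EFin \o psi) (mid x y) * (EFin \o psi) (mid x y)))%E.
  rewrite -!EFinM lee_fin.
  have := psi0 x; rewrite le_eqVlt => /predU1P[<-|px].
    by rewrite mulr0 mul0r mulr_ge0 ?expR_ge0 ?mulr_ge0.
  have := psi0 y; rewrite le_eqVlt => /predU1P[<-|py].
    by rewrite !mulr0 mulr_ge0 ?expR_ge0 ?mulr_ge0.
  rewrite mulrACA ler_pM ?mulr_ge0 ?(ltW px) ?(ltW py) ?A0 ?B0 ?psiM//.
    by apply: AB; exact: psiM.
have := PL (Fge0 _ A0) (Fge0 _ B0) (fun x => psi0 x) FGH.
rewrite !gauss_int_nice//; [|exact: cut|exact: cut].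
rewrite -!EFinM lee_fin.
have nhpsi : nice (fun x => h x * psi x) by exact: cut.
have oh : gint (fun x => h x * psi x) = 0.
  by apply: gint_odd => // x; rewrite hN psiN mulNr.
have nh2 : nice (fun x => h x ^+ 2 * psi x) by exact: cut.
have nq : nice (fun x => q x * psi x) by exact: cut.
have -> : (fun x => B x * psi x) = (fun x => (- e) * (h x * psi x) + psi x).
  by apply/funext => x; rewrite /B; ring.
have -> : (fun x => A x * psi x) = (fun x => e * (h x * psi x) +
    (e ^+ 2 * (h x ^+ 2 * psi x) + ((- e ^+ 2) * (q x * psi x) +
    ((- (e ^+ 2 * d)) * psi x + psi x)))).
  by apply/funext => x; rewrite /A; ring.
have n1 := nice_linear (- (e ^+ 2 * d)) npsi npsi.
have n2 := nice_linear (- e ^+ 2) nq n1.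
have n3 := nice_linear (e ^+ 2) nh2 n2.
rewrite !gint_linear// oh !mulr0 !add0r ler_pM2r//.
set X := gint _; set Y := gint (fun x => q x * _) => key.
have : e ^+ 2 * (X - Y - d * gint psi) <= 0 by lra.
rewrite pmulr_rle0 ?exprn_gt0//; lra.
Qed.

End poincare.

(** * Cutoffs adapted to a convex set *)

Section depth.
Context {R : realType} {n : nat}.
Variable K : set 'rV[R]_n.
Hypothesis convK : forall x y, K x -> K y -> forall t, 0 <= t <= 1 -> K (t *: x + (1 - t) *: y).
Hypothesis symK : forall x, K x -> K (- x).

Let radii (x : 'rV[R]_n) := [set r : R | r = 0 \/
  0 <= r <= 1 /\ forall z, `|z - x| < r -> K z].

(* The sup-norm distance from x to the complement of K, capped at 1 *)
Definition depth (x : 'rV[R]_n) : R := sup (radii x).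

Lemma mid_conv x y : K x -> K y -> K (mid x y).
Proof.
move=> Kx Ky; rewrite /mid (_ : _ *: _ = 2^-1 *: x + (1 - 2^-1) *: y).
  by apply: convK => //; rewrite invr_ge0 ler0n/= invf_le1// ler1n.
rewrite scalerDr; congr (_ + _ *: _); lra.
Qed.

Let radii_sup x : has_sup (radii x).
Proof.
split; first by exists 0; left.
by exists 1 => r [->//|[/andP[]]].
Qed.

Lemma depth_ge0 x : 0 <= depth x.
Proof. by apply: ub_le_sup; [case: (radii_sup x)|left]. Qed.

Lemma depth_le1 x : depth x <= 1.
Proof.
by apply: ge_sup; [case: (radii_sup x)|move=> r [->//|[/andP[]]]].
Qed.

Lemma depth_ge x c : c <= 1 -> (forall z, `|z - x| < c -> K z) -> c <= depth x.
Proof.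
move=> c1 Kc; have [c0|c0] := ltP c 0; first by rewrite (le_trans (ltW c0))// depth_ge0.
by apply: ub_le_sup; [case: (radii_sup x)|right; rewrite c0 c1].
Qed.

Lemma depth_in x z : `|z - x| < depth x -> K z.
Proof.
move=> zx; have d0 : 0 < depth x - `|z - x| by rewrite subr_gt0.
have [r] := sup_adherent d0 (radii_sup x).
rewrite -/(depth x) opprB addrCA subrr addr0 => -[->|[_]]; last exact.
by rewrite ltNge normr_ge0.
Qed.

Lemma depth_gt0 x : 0 < depth x -> K x.
Proof. by move=> d0; apply: (@depth_in x); rewrite subrr normr0. Qed.

Lemma depth_lipschitz x y : depth x - `|x - y| <= depth y.
Proof.
apply: depth_ge; first by rewrite lerBlDr (le_trans (depth_le1 x))// lerDl.
move=> z zy; apply: (@depth_in x).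
rewrite (_ : z - x = (z - y) + (y - x)); last by rewrite addrA subrK.
rewrite (le_lt_trans (ler_normD _ _))// [`|y - x|]distrC.
by rewrite -ltrBrDr.
Qed.

Lemma depth_continuous : continuous depth.
Proof.
move=> x; apply: (@cvgrPdist_lt _ _ _ (nbhs (x : 'rV[R]_n)) (nbhs_filter (x : 'rV[R]_n))
  depth (depth x)).2 => e e0.
have xe : nbhs (x : 'rV[R]_n) (ball (x : 'rV[R]_n) e) by exact: nbhsx_ballx.
apply: (filterS _ xe) => y; rewrite -ball_normE /= => xy.
rewrite ltr_norml; have := depth_lipschitz x y.
have := depth_lipschitz y x; rewrite distrC => h1 h2.
apply/andP; split; lra.
Qed.

Lemma depthN x : depth (- x) = depth x.
Proof.
have le y : depth y <= depth (- y).
  apply: depth_ge (depth_le1 y) _ => z zy; rewrite -(opprK z); apply: symK.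
  by apply: (@depth_in y); move: zy; rewrite opprK -opprD normrN.
by apply/eqP; rewrite eq_le le andbT -{2}(opprK x) le.
Qed.

(** Midpoint concavity of the distance to the complement: a displacement [v] of the midpoint is
    shared between [x] and [y] in proportion to their depths, which keeps both moved points in
    [K]. *)
Lemma depth_mid x y : 0 < depth x -> 0 < depth y ->
  (depth x + depth y) / 2 <= depth (mid x y).
Proof.
move=> dx dy; have dxy : 0 < depth x + depth y by rewrite addr_gt0.
apply: depth_ge.
  by rewrite ler_pdivrMr// mul1r; have := depth_le1 x; have := depth_le1 y; lra.
move=> z; set v := z - mid x y => vd.
set a := x + (2 * depth x / (depth x + depth y)) *: v.
set b := y + (2 * depth y / (depth x + depth y)) *: v.
have -> : z = mid a b.
  rewrite (_ : z = mid x y + v); last by rewrite addrC subrK.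
  apply/rowP => i; rewrite /a /b /mid !mxE; field.
  by rewrite gt_eqF.
have vv : 2 * `|v| / (depth x + depth y) < 1.
  by rewrite ltr_pdivrMr// mul1r mulrC -ltr_pdivlMr.
apply: mid_conv.
- apply: (@depth_in x); rewrite /a addrC addKr normrZ ger0_norm; last first.
    by rewrite divr_ge0 ?mulr_ge0 ?ltW.
  have -> : 2 * depth x / (depth x + depth y) * `|v| =
    depth x * (2 * `|v| / (depth x + depth y)) by ring.
  by rewrite gtr_pMr.
- apply: (@depth_in y); rewrite /b addrC addKr normrZ ger0_norm; last first.
    by rewrite divr_ge0 ?mulr_ge0 ?ltW.
  have -> : 2 * depth y / (depth x + depth y) * `|v| =
    depth y * (2 * `|v| / (depth x + depth y)) by ring.
  by rewrite gtr_pMr.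
Qed.

(** Here [x] may lie on the boundary, so [y] carries the whole displacement [2 *: v]; hence the
    factor one half. *)
Lemma depth_mid_in x y : K x -> depth y / 2 <= depth (mid x y).
Proof.
move=> Kx; apply: depth_ge; first by have := depth_le1 y; lra.
move=> z; set v := z - mid x y => vd.
have -> : z = mid x (y + 2 *: v).
  rewrite (_ : z = mid x y + v); last by rewrite addrC subrK.
  by apply/rowP => i; rewrite /mid !mxE; field.
apply: mid_conv => //; apply: (@depth_in y).
by rewrite addrC addKr normrZ ger0_norm// mulrC -ltr_pdivlMr.
Qed.

(** A ramp in the depth, zero up to depth [1 / s] and one from depth [2 / s] on; large [s] exhausts
    the interior of [K]. *)
Definition cutoff (s : R) (x : 'rV[R]_n) : R :=
  Num.min 1 (Num.max 0 (s * depth x - 1)).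

Lemma cutoff01 s x : 0 <= cutoff s x <= 1.
Proof. by rewrite /cutoff le_min ler01 le_max lexx ge_min lexx. Qed.

Lemma cutoffN s x : cutoff s (- x) = cutoff s x.
Proof. by rewrite /cutoff depthN. Qed.

Lemma cutoff_gt0 s x : 0 < cutoff s x -> 1 < s * depth x.
Proof. by rewrite /cutoff lt_min lt_max ltxx/= subr_gt0 => /andP[]. Qed.

Lemma cutoff_in s x : 0 < s -> 0 < cutoff s x -> K x.
Proof.
move=> s0 /cutoff_gt0 sd; apply: depth_gt0.
by rewrite -(pmulr_rgt0 _ s0) (lt_trans ltr01).
Qed.

Lemma cutoff_eq1 s x : 2 <= s * depth x -> cutoff s x = 1.
Proof.
move=> sd; apply/eqP; rewrite eq_le; have /andP[_ ->] /= := cutoff01 s x.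
by rewrite /cutoff le_min lexx le_max; apply/orP; right; lra.
Qed.

Lemma cutoff_continuous s : continuous (cutoff s).
Proof.
move=> x; rewrite /cutoff.
have cd : continuous (fun x => s * depth x + -1).
  by apply: continuous_linear; [exact: depth_continuous|exact: cst_continuous].
have cm : continuous (fun x => Num.max 0 (s * depth x - 1)).
  by move=> y; apply: (@continuous_max _ _ (cst 0) (fun x => s * depth x - 1));
    [exact: cst_continuous|exact: cd].
by apply: (@continuous_min _ _ (cst 1) (fun x => Num.max 0 (s * depth x - 1)));
  [exact: cst_continuous|exact: cm].
Qed.

(** Where it is positive, the cutoff inherits midpoint concavity from the depth, and AM-GM turns
    this into midpoint log-concavity. *)
Lemma cutoff_mid s x y : 0 < s ->
  cutoff s x * cutoff s y <= cutoff s (mid x y) ^+ 2.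
Proof.
move=> s0; have /andP[] := cutoff01 s x; rewrite le_eqVlt => /predU1P[<-|cx] cx1.
  by rewrite mul0r sqr_ge0.
have /andP[] := cutoff01 s y; rewrite le_eqVlt => /predU1P[<-|cy] cy1.
  by rewrite mulr0 sqr_ge0.
have dx : 0 < depth x.
  by rewrite -(pmulr_rgt0 _ s0) (lt_trans ltr01)// cutoff_gt0.
have dy : 0 < depth y.
  by rewrite -(pmulr_rgt0 _ s0) (lt_trans ltr01)// cutoff_gt0.
have dm : s * ((depth x + depth y) / 2) <= s * depth (mid x y).
  by rewrite ler_pM2l// depth_mid.
have le z : 0 < cutoff s z -> cutoff s z <= s * depth z - 1.
  move=> /cutoff_gt0 z0; rewrite /cutoff max_r ?ge_min ?lexx ?orbT//.
  by rewrite subr_ge0 ltW.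
have lex := le _ cx; have ley := le _ cy.
have m : (cutoff s x + cutoff s y) / 2 <= cutoff s (mid x y).
  rewrite {3}/cutoff le_min le_max; apply/andP; split; first lra.
  by apply/orP; right; lra.
apply: (@le_trans _ _ (((cutoff s x + cutoff s y) / 2) ^+ 2)).
  rewrite -subr_ge0 (_ : _ - _ = ((cutoff s x - cutoff s y) / 2) ^+ 2) ?sqr_ge0//.
  by field.
rewrite lerXn2r ?nnegrE//; first by rewrite divr_ge0// addr_ge0 ?ltW.
by case/andP: (cutoff01 s (mid x y)).
Qed.

(** On the support [s * depth y] exceeds 1. Passing to the midpoint halves the depth and the ramp
    saturates at 2, so scale [4 * s] makes the right-hand side 1. *)
Lemma cutoff_mid_in s x y : 0 < s -> K x ->
  cutoff s y <= cutoff (4 * s) (mid x y) ^+ 2.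
Proof.
move=> s0 Kx; have /andP[] := cutoff01 s y; rewrite le_eqVlt => /predU1P[<-|cy] cy1.
  by rewrite sqr_ge0.
rewrite [cutoff (4 * s) _]cutoff_eq1 ?expr1n//.
have := depth_mid_in y Kx; rewrite -(ler_pM2l s0).
by have := cutoff_gt0 cy; lra.
Qed.

End depth.

(** * Truncation and positivity *)

Section truncation.
Context {R : realType}.
Local Open Scope ereal_scope.

(** Subadditivity is recovered for a constant summand: if a simple [h] lies below [F + c], the
    positive part of [h - c] is measurable and lies below [F]. *)
Lemma lower_integral_gamma1_addr (F : R -> \bar R) (c : R) : (0 <= c)%R ->
  (forall t, 0 <= F t) ->
  \int[gamma1]_t (F t + c%:E) <= \int[gamma1]_t F t + c%:E.
Proof.
move=> c0 F0; apply: lower_integral_le => [t|h hF].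
  by rewrite adde_ge0// lee_fin.
pose h' (t : measurableTypeR R) := Num.max 0%R (h t - c)%R.
have mh' : measurable_fun setT h'.
  by apply: measurable_maxr => //; exact: measurable_funB.
have h'0 t : (0 <= h' t)%R by rewrite /h' le_max lexx.
apply: (@le_trans _ _ (\int[gamma1]_t ((h' t)%:E + (cst c%:E t : \bar R)))).
  apply: le_lower_integral => t; first by rewrite lee_fin.
  rewrite -EFinD lee_fin /h' -lerBlDr le_max lexx orbT//.
have -> : \int[gamma1]_t ((h' t)%:E + (cst c%:E t : \bar R)) =
    \int[gamma1]_t (h' t)%:E + \int[gamma1]_t (cst c%:E t : \bar R).
  by apply: ge0_integralD => //; first [move=> t _; rewrite lee_fin//|exact/measurable_EFinP].
have -> := integral_cst (normal_prob 0 1) (@measurableT _ (measurableTypeR R)) c%:E.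
rewrite [X in _ * X]gamma1_setT mule1 leeD2r//.
apply: le_lower_integral => t; first by rewrite lee_fin.
rewrite /h' EFin_max ge_max F0/= EFinB leeBlDr//.
Qed.

Lemma lower_integral_gamma1_restrict (F : R -> \bar R) (A : set R) : measurable A ->
  (forall t, 0 <= F t <= 1) ->
  \int[gamma1]_t F t <= \int[gamma1]_t ((\1_A t)%:E * F t) + gamma1 (~` A).
Proof.
move=> mA F01; have F0 t : 0 <= F t by case/andP: (F01 t).
apply: lower_integral_le => // h hF.
have h1 t : (h t <= 1)%R.
  by rewrite -lee_fin (le_trans (hF t))//; case/andP: (F01 t).
have mh (B : set R) : measurable B ->
    measurable_fun setT (fun t : measurableTypeR R => ((\1_B t * h t)%R)%:E).
  move=> mB; apply/measurable_EFinP.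
  have mi : measurable_fun setT (\1_B : measurableTypeR R -> R).
    by apply: measurable_indic; exact: mB.
  exact: measurable_funM.
have mAC : measurable (~` A) by exact: measurableC.
have -> : \int[gamma1]_t (h t)%:E =
    \int[gamma1]_t ((\1_A t * h t)%:E + (\1_(~` A) t * h t)%:E).
  apply: eq_integral => t _; rewrite -EFinD -mulrDl !indicE in_setC.
  by case: (t \in A); rewrite ?addr0 ?add0r mul1r.
have -> : \int[gamma1]_t ((\1_A t * h t)%:E + (\1_(~` A) t * h t)%:E) =
    \int[gamma1]_t (\1_A t * h t)%:E + \int[gamma1]_t (\1_(~` A) t * h t)%:E.
  by apply: ge0_integralD => //; first [move=> t _; rewrite lee_fin mulr_ge0//|exact: mh].
apply: leeD.
  apply: le_lower_integral => t; first by rewrite lee_fin mulr_ge0.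
  by rewrite EFinM lee_wpmul2l// lee_fin.
have -> : gamma1 (~` A) = \int[gamma1]_t (\1_(~` A) t)%:E.
  rewrite -[LHS](congr1 _ (setIT (~` A))).
  exact/esym/integral_indic.
apply: le_lower_integral => t; first by rewrite lee_fin mulr_ge0.
by rewrite lee_fin ler_piMr.
Qed.

Definition tail (M : R) : R := fine (gamma1 (~` [set t : R | (`|t| <= M)%R])).

Lemma measurable_abs_le (M : R) : measurable [set t : R | (`|t| <= M)%R].
Proof.
rewrite (_ : [set _ | _] = `[(- M)%R, M]%classic); first exact: measurable_itv.
by apply/seteqP; split => t /=; rewrite in_itv/= ler_norml.
Qed.

Lemma tailE (M : R) : gamma1 (~` [set t : R | (`|t| <= M)%R]) = (tail M)%:E.
Proof.
rewrite /tail fineK//; apply: fin_num_measure.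
by apply: measurableC; exact: measurable_abs_le.
Qed.

Lemma tail_ge0 M : (0 <= tail M)%R.
Proof. exact: fine_ge0. Qed.

Lemma cvg_tail : (fun m : nat => tail m%:R) @ \oo --> 0%R.
Proof.
suff H : (fun m : nat => (tail m%:R)%:E) @ \oo --> (0%R : R)%:E by move/fine_cvg: H.
under eq_fun do rewrite -tailE.
have -> : (0%R : R)%:E = gamma1 (\bigcap_m ~` [set t : R | (`|t| <= m%:R)%R]).
  rewrite (_ : \bigcap_m _ = set0) ?measure0//.
  rewrite -subset0 => t /= H.
  have [m tm] : exists m : nat, (`|t| <= m%:R)%R.
    by exists (Num.truncn `|t|).+1; rewrite ltW// truncnS_gt.
  exact: (H m I).
have mC m : measurable (~` [set t : R | (`|t| <= m%:R)%R]).
  by apply: measurableC; exact: measurable_abs_le.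
apply: (@nonincreasing_cvg_mu _ _ _ (normal_prob 0 1)) => //.
- by rewrite -ge0_fin_numE//; apply: fin_num_measure; exact: (mC 0%N).
- exact: bigcapT_measurable.
- move=> a b ab; apply/subsetPset => t /= H1 H2; apply: H1.
  by rewrite (le_trans H2)// ler_nat.
Qed.

(** A union bound, with one tail per coordinate, carried through the induction because [F] need not
    be measurable. *)
Lemma gauss_iter_truncate k (F : (nat -> R) -> \bar R) (M : R) x :
  (forall y, 0 <= F y <= 1) ->
  gauss_iter k F x <= gauss_iter k
    (fun y => (\1_[set y : nat -> R | forall j, (j < k)%N -> (`|y j| <= M)%R] y)%:E * F y) x
    + (k%:R * tail M)%:E.
Proof.
move=> F01; have F0 y : 0 <= F y by case/andP: (F01 y).
pose box k := [set y : nat -> R | forall j, (j < k)%N -> (`|y j| <= M)%R].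
have G0 k' y : 0 <= (\1_(box k') y)%:E * F y by rewrite mule_ge0// lee_fin.
rewrite -/(box k); elim: k x => [|k IH] x.
  rewrite mul0r adde0 /= indicE mem_set ?mul1e//.
rewrite !gauss_iterS.
have mA := measurable_abs_le M.
set A := [set t : R | (`|t| <= M)%R] in mA.
apply: (@le_trans _ _ (\int[gamma1]_t ((\1_A t)%:E * gauss_iter k F (upd x k t)) + gamma1 (~` A))).
  apply: lower_integral_gamma1_restrict => // t; rewrite gauss_iter_ge0//=.
  rewrite -(gauss_iter_cst k 1 (upd x k t)); apply: gauss_iter_le => // y _.
  by case/andP: (F01 y).
rewrite tailE -[k.+1%:R]natr1 mulrDl mul1r EFinD addeA leeD2r//.
apply: (@le_trans _ _ (\int[gamma1]_t
  (gauss_iter k (fun y => (\1_(box k.+1) y)%:E * F y) (upd x k t) + (k%:R * tail M)%:E))); last first.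
  apply: lower_integral_gamma1_addr; first by rewrite mulr_ge0// tail_ge0.
  by move=> t; exact: gauss_iter_ge0.
apply: le_lower_integral => t.
  by rewrite mule_ge0 ?lee_fin// gauss_iter_ge0.
rewrite indicE; case: (boolP (t \in A)) => [/set_mem tA|_]; last first.
  rewrite mul0e adde_ge0 ?gauss_iter_ge0// lee_fin mulr_ge0// tail_ge0//.
rewrite mul1e (le_trans (IH _))// leeD2r//.
apply: gauss_iter_le => // y yx.
(* The inner integration leaves coordinate [k] equal to [t], which already satisfies the bound. *)
suff eqb : (y \in box k.+1) = (y \in box k) by rewrite !indicE eqb.
apply/idP/idP => /set_mem By; apply/mem_set => j jk; first exact: By (ltnW jk).
move: jk; rewrite ltnS leq_eqVlt => /predU1P[->|]; last exact: By.
by rewrite (yx k)// /upd eqxx.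
Qed.

Lemma gamma1_itv_gt0 (c r : R) : (0 < r)%R ->
  exists2 b : R, (0 < b)%R & b%:E <= gamma1 [set t : R | (`|t - c| < r)%R].
Proof.
move=> r0; set A := [set t : R | _].
have AE : A = `](c - r)%R, (c + r)%R[%classic.
  by apply/seteqP; split => t; rewrite /A/= in_itv/= ltr_distl.
have mA : measurable A by rewrite AE; exact: measurable_itv.
have cr : (c - r <= c + r)%R by lra.
have cpdf : {within `[(c - r)%R, (c + r)%R], continuous (@normal_pdf R 0 1)}.
  by apply: continuous_subspaceT; apply: continuous_normal_pdf; rewrite oner_eq0.
have [m _ mmin] := EVT_min cr cpdf.
exists (normal_pdf 0 1 m * (2 * r))%R; first by rewrite mulr_gt0 ?normal_pdf_gt0 ?mulr_gt0.
rewrite gamma1E.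
apply: (@le_trans _ _
  (\int[lebesgue_measure]_(t in A) (cst (normal_pdf 0 1 m)%:E t : \bar R))).
  rewrite integral_cst//= AE lebesgue_measure_itv/= lte_fin.
  rewrite ifT; last by lra.
  rewrite -EFinB -EFinM lee_fin; rewrite (_ : c + r - (c - r) = 2 * r)%R//; lra.
apply: ge0_le_integral => //.
- by move=> t _; rewrite lee_fin normal_pdf_ge0.
- by apply/measurable_EFinP/measurable_funTS; exact: measurable_normal_pdf.
- move=> t; rewrite AE/= in_itv/= => /andP[t1 t2]; rewrite lee_fin mmin// in_itv/=.
  by rewrite !ltW.
Qed.

(** [b] is a product of lower bounds for the measures of intervals around the [c j]. Choosing it
    before [F] and [x] makes the induction hypothesis uniform in the outer variable. *)
Lemma gauss_iter_gt0 k (c : nat -> R) (r : R) : (0 < r)%R ->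
  exists2 b : R, (0 < b)%R & forall (F : (nat -> R) -> \bar R) x,
    (forall y, 0 <= F y) ->
    (forall y, (forall j, (j < k)%N -> (`|y j - c j| < r)%R) ->
       (forall j, (k <= j)%N -> y j = x j) -> 1 <= F y) ->
    b%:E <= gauss_iter k F x.
Proof.
move=> r0; elim: k => [|k [b b0 IH]].
  by exists 1%R => // F x F0 F1; exact: F1.
have [a a0 ha] := gamma1_itv_gt0 (c k) r0.
exists (b * a)%R; first by rewrite mulr_gt0.
move=> F x F0 F1; rewrite gauss_iterS.
set A := [set t : R | (`|t - c k| < r)%R] in ha.
have mA : measurable A.
  rewrite (_ : A = `](c k - r)%R, (c k + r)%R[%classic); first exact: measurable_itv.
  by apply/seteqP; split => t; rewrite /A/= in_itv/= ltr_distl.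
apply: (@le_trans _ _ (\int[gamma1]_t (b%:E * (\1_A t)%:E))).
  rewrite ge0_integralZl//; last 2 first.
  - by apply/measurable_EFinP; exact: (@measurable_indic _ (measurableTypeR R)).
  - by rewrite lee_fin ltW.
  have -> := @integral_indic _ (measurableTypeR R) R (normal_prob 0 1) setT measurableT A mA.
  by rewrite setIT EFinM lee_wpmul2l// lee_fin ltW.
apply: le_lower_integral => t; first by rewrite mule_ge0 ?lee_fin// ltW.
rewrite indicE; case: (boolP (t \in A)) => [/set_mem tA|_]; last first.
  by rewrite mule0 gauss_iter_ge0.
rewrite mule1; apply: IH => // y yc yx; apply: F1.
  move=> j; rewrite ltnS leq_eqVlt => /predU1P[->|]; last exact: yc.
  by rewrite (yx k)// /upd eqxx.
by move=> j kj; rewrite (yx j) ?(ltnW kj)// /upd gtn_eqF.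
Qed.

End truncation.

(** * Calculus and the energy identity *)

Section calculus.
Context {R : realType} {n : nat}.
Implicit Types (u w : 'rV[R]_n -> R) (x y v : 'rV[R]_n).

Lemma evec_sum v : v = \sum_(i < n) v 0 i *: evec i.
Proof.
apply/rowP => j; rewrite summxE (bigD1 j)//= !mxE eqxx mulr1 big1 ?addr0// => i ij.
by rewrite !mxE (negbTE ij) mulr0.
Qed.

Lemma derive_pd u x v : differentiable u x ->
  'D_v u x = \sum_(i < n) v 0 i * pd i u x.
Proof.
move=> du; rewrite deriveE// {1}(evec_sum v) linear_sum; apply: eq_bigr => i _.
by rewrite linearZ/= /pd deriveE.
Qed.

Lemma is_derive_line u x v (t : R) : differentiable u (x + t *: v) ->
  is_derive t 1 (fun s : R => u (x + s *: v)) ('D_v u (x + t *: v)).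
Proof.
move=> du.
have E : (fun h : R => h^-1 *: (((fun s : R => u (x + s *: v)) \o shift t) (h *: (1 : R)) -
      u (x + t *: v))) =
    (fun h : R => h^-1 *: ((u \o shift (x + t *: v)) (h *: v) - u (x + t *: v))).
  apply/funext => h /=; congr (_ *: (u _ - _)).
  by apply/rowP => i; rewrite !mxE /GRing.scale/=; ring.
split; first by rewrite /derivable E; exact: diff_derivable.
by rewrite /derive E.
Qed.

Lemma mean_value u x y : (forall z, differentiable u z) ->
  exists2 t : R, 0 <= t <= 1 &
    u x - u y = \sum_(i < n) (x - y) 0 i * pd i u (y + t *: (x - y)).
Proof.
move=> du; pose f (t : R) := u (y + t *: (x - y)).
have df (t : R) : is_derive t 1 f ('D_(x - y) u (y + t *: (x - y))).
  exact: is_derive_line.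
have cf : continuous f.
  by move=> t; apply: differentiable_continuous; apply/derivable1_diffP; case: (df t).
have [t t01] := @MVT_segment R f _ 0 1 ler01 (fun t _ => df t) (continuous_subspaceT cf).
have -> : f 1 = u x by rewrite /f scale1r addrC subrK.
have -> : f 0 = u y by rewrite /f scale0r addr0.
rewrite subr0 mulr1 => E.
exists t; first by move: t01; rewrite in_itv.
by rewrite E derive_pd.
Qed.

Lemma cauchy_schwarz_sum (a b : 'I_n -> R) :
  (\sum_i a i * b i) ^+ 2 <= (\sum_i b i ^+ 2) * (\sum_i a i ^+ 2).
Proof.
set A := \sum_i a i ^+ 2; set B := \sum_i b i ^+ 2; set C := \sum_i a i * b i.
have quad (s t : R) : 0 <= s ^+ 2 * A - 2 * s * t * C + t ^+ 2 * B.
  have -> : s ^+ 2 * A - 2 * s * t * C + t ^+ 2 * B = \sum_i (s * a i - t * b i) ^+ 2.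
    rewrite !mulr_sumr -sumrB -big_split/=; apply: eq_bigr => i _; ring.
  by apply: sumr_ge0 => i _; exact: sqr_ge0.
have B0 : 0 <= B by apply: sumr_ge0 => i _; exact: sqr_ge0.
move: B0; rewrite le_eqVlt => /predU1P[B0|B0]; last first.
  (* This choice minimises the quadratic form up to scaling and produces the discriminant. *)
  have := quad B C.
  have -> : B ^+ 2 * A - 2 * B * C * C + C ^+ 2 * B = B * (B * A - C ^+ 2) by ring.
  by rewrite pmulr_rge0// subr_ge0.
rewrite -B0 mul0r.
have b0 i : b i = 0.
  apply/eqP; rewrite -sqrf_eq0; apply/eqP.
  have /psumr_eq0P : \sum_i b i ^+ 2 = 0 by rewrite -/B -B0.
  by apply => // j _; exact: sqr_ge0.
rewrite /C big1 ?expr0n// => i _; by rewrite b0 mulr0.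
Qed.

Lemma pd_odd u i x : (forall z, differentiable u z) -> (forall z, u (- z) = u z) ->
  pd i u (- x) = - pd i u x.
Proof.
move=> du uN; rewrite /pd.
have -> : 'D_(evec i) u (- x) = 'D_(- evec i) u x.
  have E : (fun h : R => h^-1 *: ((u \o shift (- x)) (h *: evec i) - u (- x))) =
      (fun h : R => h^-1 *: ((u \o shift x) (h *: - evec i) - u x)).
    by apply/funext => h /=; rewrite uN -uN opprD opprK scalerN.
  by rewrite /derive E.
by rewrite !deriveE// linearN.
Qed.

End calculus.

(** * Pointwise lower bound for the energy *)

Section main_estimate.
Context {R : realType} {n : nat}.
Implicit Types (u w : 'rV[R]_n -> R) (x y v : 'rV[R]_n).

Lemma coord_continuous_row (j : 'I_n) : continuous (fun x : 'rV[R]_n => x 0 j).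
Proof. by move=> x; exact: coord_continuous. Qed.

Lemma derive_coord (j : 'I_n) x v : 'D_v (fun y : 'rV[R]_n => y 0 j) x = v 0 j.
Proof.
rewrite deriveE; last exact: differentiable_coord.
pose f : 'rV[R]_n -> R := fun y => y 0 j.
have fl : linear f by move=> a y z; rewrite /f !mxE.
pose fL := GRing.isLinear.Build _ _ _ _ f fl.
pose F : {linear 'rV[R]_n -> R} := HB.pack f fL.
rewrite -/f (_ : f = F)// diff_lin//; exact: coord_continuous_row.
Qed.

Lemma continuous_bigsum (I : Type) (r : seq I) (F : I -> 'rV[R]_n -> R) :
  (forall i, continuous (F i)) -> continuous (fun x => \sum_(i <- r) F i x).
Proof.
move=> cF; elim: r => [|i r IH].
  by under eq_fun do rewrite big_nil; exact: cst_continuous.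
under eq_fun do rewrite big_cons -[F i _]mul1r.
exact: continuous_linear.
Qed.

Lemma continuous_sqr w : continuous w -> continuous (fun x => w x ^+ 2).
Proof. by move=> cw x; exact: (cvgM (cw x) (cw x)). Qed.

(* [shifted u j] is the [j]-th derivative of [u - |x|^2 / (2 n)] and
   [shifted_grad2 u j] the squared norm of its gradient. *)
Definition shifted u (j : 'I_n) x : R := - n%:R^-1 * x 0 j + pd j u x.

Definition shifted_grad2 u (j : 'I_n) x : R :=
  \sum_(i < n) (pd i (pd j u) x - (i == j)%:R / n%:R) ^+ 2.

Lemma differentiable_shifted u j x : differentiable (pd j u) x ->
  differentiable (shifted u j) x.
Proof.
move=> du; apply: (@differentiableD _ _ _ (fun x => - n%:R^-1 * x 0 j) (pd j u)) => //.
exact: (differentiableZ (- n%:R^-1) (differentiable_coord x 0 j)).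
Qed.

Lemma pd_shifted u i j x : differentiable (pd j u) x ->
  pd i (shifted u j) x = pd i (pd j u) x - (i == j)%:R / n%:R.
Proof.
move=> du; rewrite /pd /shifted.
have dc : derivable (fun y : 'rV[R]_n => y 0 j) x (evec i).
  by apply: diff_derivable; exact: differentiable_coord.
have := @deriveD _ _ _ ((- n%:R^-1) \*: (fun y : 'rV[R]_n => y 0 j)) (pd j u) x (evec i)
  (derivableZ dc) (diff_derivable du).
rewrite deriveZ// derive_coord mxE => H.
transitivity (- n%:R^-1 *: (i == j)%:R + 'D_(evec i) (pd j u) x); first exact: H.
by rewrite addrC; congr (_ + _); rewrite /GRing.scale/= mulNr mulrC.
Qed.

Lemma shifted_mean_value u j x y : (forall z, differentiable (pd j u) z) ->
  exists2 t, 0 <= t <= 1 & (shifted u j x - shifted u j y) ^+ 2 <=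
    shifted_grad2 u j (y + t *: (x - y)) * eucl_norm2 (x - y).
Proof.
move=> du.
have [t t01 E] := mean_value x y (fun z => differentiable_shifted (du z)).
exists t => //; rewrite E /shifted_grad2 /eucl_norm2.
apply: le_trans (cauchy_schwarz_sum _ _) _.
by under eq_bigr do rewrite pd_shifted//.
Qed.

Lemma shifted_odd u j x : (forall z, differentiable u z) ->
  (forall z, u (- z) = u z) -> shifted u j (- x) = - shifted u j x.
Proof. by move=> du uN; rewrite /shifted pd_odd// mxE mulrN opprD. Qed.

(** After expanding the squares, [OU u x = 1] turns the Laplacian and drift terms into [- 2 / n],
    which cancels the two contributions [1 / n]. The right side exceeds the left by
    [|x|^2 / n^2 + 2 |grad u|^2] in Euclidean norms. *)
Lemma energy_lower_bound u x : (0 < n)%N -> OU u x = 1 ->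
  n%:R^-1 + \sum_(j < n) (shifted_grad2 u j x - shifted u j x ^+ 2) <=
  hs_norm2 (hessian u x) + eucl_norm2 (grad u x).
Proof.
move=> n0; rewrite /OU /laplacian => ou.
have nn0 : n%:R != 0 :> R by rewrite pnatr_eq0 -lt0n.
have -> : \sum_(j < n) (shifted_grad2 u j x - shifted u j x ^+ 2) =
    hs_norm2 (hessian u x) - 2 / n%:R * \sum_(j < n) pd j (pd j u) x
    + \sum_(j < n) n%:R^-2
    - n%:R^-2 * \sum_(j < n) x 0 j ^+ 2 + 2 / n%:R * \sum_(j < n) x 0 j * pd j u x
    - eucl_norm2 (grad u x).
  rewrite /hs_norm2 exchange_big/= /eucl_norm2.
  rewrite !mulr_sumr -!sumrB -!big_split/= -!sumrB.
  rewrite -!big_split/= -!sumrB.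
  apply: eq_bigr => j _.
  have -> : shifted_grad2 u j x = \sum_(i < n) hessian u x i j ^+ 2
      - 2 / n%:R * pd j (pd j u) x + n%:R^-2.
    rewrite /shifted_grad2 (bigD1 j)//= [in RHS](bigD1 j)//= eqxx !mxE.
    rewrite (eq_bigr (fun i => hessian u x i j ^+ 2)); last first.
      by move=> i ij; rewrite (negbTE ij) mul0r subr0 !mxE.
    set T := \sum_(i < n | _) _; rewrite (_ : true%:R = 1 :> R)//.
    by field.
  rewrite /shifted /grad !mxE; field.
  exact: nn0.
have -> : \sum_(j < n) n%:R^-2 = n%:R^-1 :> R.
  by rewrite sumr_const card_ord -mulr_natl; field.
rewrite (_ : \sum_(j < n) pd j (pd j u) x = 1 + \sum_(j < n) x 0 j * pd j u x); last by lra.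
have G0 : 0 <= eucl_norm2 (grad u x) by apply: sumr_ge0 => i _; exact: sqr_ge0.
have X0 : 0 <= n%:R^-2 * \sum_(j < n) x 0 j ^+ 2.
  by rewrite mulr_ge0// ?invr_ge0 ?exprn_ge0// sumr_ge0// => i _; exact: sqr_ge0.
have -> : 2 / n%:R * (1 + \sum_(j < n) x 0 j * pd j u x) =
  n%:R^-1 + n%:R^-1 + 2 / n%:R * \sum_(j < n) x 0 j * pd j u x by field.
lra.
Qed.

End main_estimate.

(** * From cutoffs to bounded pieces of K *)

Section assembly.
Context {R : realType} {n : nat}.
Variables (K : set 'rV[R]_n) (u : 'rV[R]_n -> R).
Hypothesis convK : forall x y, K x -> K y -> forall t, 0 <= t <= 1 -> K (t *: x + (1 - t) *: y).
Hypothesis symK : forall x, K x -> K (- x).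
Hypothesis uC2 : C2 u.
Hypothesis uN : forall x, u (- x) = u x.
Hypothesis uOU : forall x, K x -> OU u x = 1.
Hypothesis n0 : (0 < n)%N.

Let energy (x : 'rV[R]_n) : R := hs_norm2 (hessian u x) + eucl_norm2 (grad u x).

Let energy_ge0 x : 0 <= energy x.
Proof.
rewrite addr_ge0//; last by apply: sumr_ge0 => i _; exact: sqr_ge0.
by apply: sumr_ge0 => i _; apply: sumr_ge0 => j _; exact: sqr_ge0.
Qed.

Let energy_continuous : continuous energy.
Proof.
have [du [dpu cpu]] := uC2.
have -> : energy = fun x => 1 * hs_norm2 (hessian u x) + eucl_norm2 (grad u x).
  by apply/funext => x; rewrite mul1r.
apply: continuous_linear.
  apply: continuous_bigsum => i; apply: continuous_bigsum => j.
  apply: continuous_sqr; under eq_fun do rewrite mxE; exact: cpu.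
apply: continuous_bigsum => i; apply: continuous_sqr.
under eq_fun do rewrite mxE.
by move=> x; apply: differentiable_continuous; exact: dpu.
Qed.

(** The pointwise bound is integrated against [psi], which is at most the indicator of [K];
    [poincare_odd] makes the contribution of each [shifted u j] nonnegative. *)
Lemma cutoff_energy (psi : 'rV[R]_n -> R) (M : R) :
  continuous psi -> (forall x, 0 <= psi x <= 1) ->
  (forall x, psi (- x) = psi x) -> (forall x, 0 < psi x -> `|x| <= M) ->
  (forall x y, psi x * psi y <= psi (mid x y) ^+ 2) ->
  (forall x, 0 < psi x -> K x) -> 0 < gint psi ->
  ((n%:R^-1 * gint psi)%:E <= gauss_int (fun x => (\1_K x)%:E * (energy x)%:E))%E.
Proof.
move=> cpsi psi01 psiN psiM psimid psiK psi_gt0.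
have [du [dpu cpu]] := uC2.
have psi0 x : 0 <= psi x by case/andP: (psi01 x).
have cut (f : 'rV[R]_n -> R) : continuous f -> nice (fun x => f x * psi x).
  by move=> cf; exact: nice_cutoff psiM.
have npsi : nice psi.
  have : nice (fun x => 1 * psi x) by apply: cut; exact: cst_continuous.
  by under eq_fun do rewrite mul1r.
have cs j : continuous (shifted u j).
  apply: continuous_linear; first exact: coord_continuous_row.
  by move=> x; apply: differentiable_continuous; exact: dpu.
have cg j : continuous (shifted_grad2 u j).
  apply: continuous_bigsum => i; apply: continuous_sqr.
  have -> : (fun x => pd i (pd j u) x - (i == j)%:R / n%:R) =
      (fun x => 1 * pd i (pd j u) x + - ((i == j)%:R / n%:R)).
    by apply/funext => x; rewrite mul1r.
  by apply: continuous_linear; [exact: cpu|exact: cst_continuous].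
have poin j : gint (fun x => shifted u j x ^+ 2 * psi x) <=
    gint (fun x => shifted_grad2 u j x * psi x).
  apply: (poincare_odd cpsi psi01 psiN psiM psimid psi_gt0) => //.
  - by move=> x; exact: shifted_odd.
  - by move=> x; apply: sumr_ge0 => i _; exact: sqr_ge0.
  - by move=> x y; exact: shifted_mean_value.
apply: (@le_trans _ _ (gauss_int (EFin \o (fun x => energy x * psi x)))); last first.
  apply: gauss_int_le => x; first by rewrite lee_fin mulr_ge0.
  rewrite /= -EFinM lee_fin mulrC indicE; move: (psi0 x).
  rewrite le_eqVlt => /predU1P[<-|px]; first by rewrite mul0r mulr_ge0.
  by rewrite (mem_set (psiK _ px)) ler_wpM2r//; case/andP: (psi01 x).
rewrite gauss_int_nice; last exact: cut.
rewrite lee_fin.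
pose T j x := -1 * (shifted u j x ^+ 2 * psi x) + shifted_grad2 u j x * psi x.
have n1 j : nice (fun x => shifted u j x ^+ 2 * psi x).
  by apply: cut; exact: continuous_sqr.
have n2 j : nice (fun x => shifted_grad2 u j x * psi x) by exact: cut.
have nT j : nice (T j) by apply: nice_linear.
have nS : nice (fun x => \sum_(j < n) T j x) by exact: nice_sum.
apply: (@le_trans _ _ (gint (fun x => n%:R^-1 * psi x + \sum_(j < n) T j x))).
  rewrite gint_linear// lerDl gint_sum// sumr_ge0// => j _.
  by rewrite gint_linear// mulN1r addrC subr_ge0.
apply: gint_le; [exact: nice_linear|exact: cut|] => x.
(* Where [psi] vanishes so do both sides; where it is positive, [x] is in [K] and the equation for
   [u] is available. *)
move: (psi0 x); rewrite le_eqVlt => /predU1P[p0|px].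
  by rewrite -p0 !mulr0 add0r big1// => j _; rewrite /T -p0 !mulr0 addr0.
apply: le_trans (_ : (n%:R^-1 + \sum_(j < n) (shifted_grad2 u j x - shifted u j x ^+ 2)) * psi x <= _).
  rewrite mulrDl mulr_suml lerD2l ler_sum// => j _; rewrite /T mulN1r addrC mulrBl//.
by rewrite ler_wpM2r// energy_lower_bound// uOU//; exact: psiK.
Qed.

(** Cutting with a ball keeps convexity and symmetry and gives the cutoffs bounded support. *)
Let KM (M : R) := K `&` [set x | `|x| <= M].

Let convKM M x y : KM M x -> KM M y -> forall t, 0 <= t <= 1 -> KM M (t *: x + (1 - t) *: y).
Proof.
move=> [Kx xM] [Ky yM] t t01; split; first exact: convK.
have := norm_segment_le t01 xM yM; rewrite (_ : _ + _ = t *: x + (1 - t) *: y)//.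
by rewrite scalerBr scalerBl scale1r addrCA addrC.
Qed.

Let symKM M x : KM M x -> KM M (- x).
Proof. by move=> [Kx xM]; split; [exact: symK|rewrite /= normrN]. Qed.

Lemma gamma_n_fin (A : set 'rV[R]_n) : (gamma_n A \is a fin_num) /\ (gamma_n A <= 1)%E.
Proof.
have A1 : (gamma_n A <= 1)%E.
  rewrite -[leRHS](@gauss_iter_cst R n 1 (fun=> 0)); apply: gauss_iter_le => y.
    by rewrite lee_fin.
  by move=> _; rewrite lee_fin indicE; case: (_ \in _).
split => //; rewrite ge0_fin_numE; first by rewrite (le_lt_trans A1)// ltry.
by apply: gauss_int_ge0 => x; rewrite lee_fin.
Qed.

(** [cutoff_energy] bounds every cutoff mass by [n%:R * c]. Prekopa-Leindler for the indicator of
    [KM M] and the cutoffs at scales [s] and [4 * s] transfers this to the measure of [KM M];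
    positivity at [s0] permits division by the supremum. *)
Lemma gamma_n_truncated_le (M s0 c : R) : 0 < s0 -> 0 < gint (cutoff (KM M) s0) ->
  (gauss_int (fun x => (\1_K x)%:E * (energy x)%:E) <= c%:E)%E ->
  fine (gamma_n (KM M)) <= n%:R * c.
Proof.
move=> s00 a0 Xc.
pose a s := gint (cutoff (KM M) s).
have c0 : 0 <= c.
  rewrite -lee_fin; apply: le_trans Xc; apply: gauss_int_ge0 => x.
  by rewrite mule_ge0 ?lee_fin.
have nc0 : 0 <= n%:R * c by rewrite mulr_ge0.
have inKM s x : 0 < s -> 0 < cutoff (KM M) s x -> KM M x by exact: cutoff_in.
have ac s : 0 < s -> a s <= n%:R * c.
  move=> sgt0; have [as0|as0] := leP (a s) 0; first exact: le_trans as0 nc0.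
  rewrite -ler_pdivrMl ?ltr0n// -lee_fin; apply: le_trans Xc.
  apply: (@cutoff_energy _ M) => //.
  - exact: cutoff_continuous.
  - exact: cutoff01.
  - by move=> x; apply: cutoffN; exact: symKM.
  - by move=> x /(inKM _ _ sgt0)[].
  - by move=> x y; apply: cutoff_mid => //; exact: convKM.
  - by move=> x /(inKM _ _ sgt0)[].
have nice_cut s : nice (cutoff (KM M) s).
  split; first exact: cutoff_continuous.
  by exists 1 => // x; have /andP[? ?] := cutoff01 (KM M) s x; rewrite ger0_norm.
have [gfin _] := gamma_n_fin (KM M).
set g := fine (gamma_n (KM M)).
have ga s : 0 < s -> g * a s <= a (4 * s) ^+ 2.
  move=> sgt0; rewrite -lee_fin EFinM (fineK gfin) expr2 EFinM -!gauss_int_nice//.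
  apply: gauss_int_prekopa_leindler => [x|x|x|x y].
  - by rewrite lee_fin.
  - by rewrite lee_fin; case/andP: (cutoff01 (KM M) s x).
  - by rewrite lee_fin; case/andP: (cutoff01 (KM M) (4 * s) x).
  rewrite -!EFinM lee_fin -expr2 indicE.
  have e1 : 1 <= expR (eucl_norm2 (x - y) / 4).
    rewrite -expR0 ler_expR divr_ge0// sumr_ge0// => i _; exact: sqr_ge0.
  case: (boolP (x \in _)) => [/set_mem Kx|_]; last first.
    by rewrite mul0r mulr_ge0 ?expR_ge0 ?sqr_ge0.
  rewrite mul1r (le_trans (cutoff_mid_in (@convKM M) y sgt0 Kx))//.
  by rewrite ler_peMl ?sqr_ge0.
(* [g * a s <= a (4 s)^2] for all [s], so [g <= sup a]: no limit of cutoffs is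
   needed. *)
pose S := [set r | exists2 s, 0 < s & r = a s].
have supS : has_sup S.
  split; first by exists (a s0), s0.
  by exists (n%:R * c) => _ [s sgt0 ->]; exact: ac.
have leS s : 0 < s -> a s <= sup S.
  by move=> sgt0; apply: ub_le_sup; [case: supS|exists s].
have S0 : 0 < sup S by rewrite (lt_le_trans a0)// leS.
have a_ge0 s : 0 <= a s.
  by apply: gint_ge0 => x; case/andP: (cutoff01 (KM M) s x).
have g0 : 0 <= g by apply: fine_ge0; apply: gauss_int_ge0 => x; rewrite lee_fin.
have key : g * sup S <= sup S ^+ 2.
  move: g0; rewrite le_eqVlt => /predU1P[<-|g0]; first by rewrite mul0r sqr_ge0.
  rewrite -ler_pdivlMl//; apply: ge_sup; first by case: supS.
  move=> _ [s sgt0 ->]; rewrite ler_pdivlMl// (le_trans (ga _ sgt0))//.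
  by rewrite lerXn2r ?nnegrE ?(ltW S0) ?leS ?mulr_gt0.
apply: (@le_trans _ _ (sup S)); first by rewrite -(ler_pM2r S0) -expr2.
by apply: ge_sup; [case: supS|move=> _ [s sgt0 ->]; exact: ac].
Qed.

End assembly.

(** * The inequality on K *)

Lemma convex_set_conv (R : realType) (n : nat) (K : set 'rV[R]_n) :
  convex_set (K : set (convex_lmodType 'rV[R]_n)) ->
  forall x y, K x -> K y -> forall t, 0 <= t <= 1 -> K (t *: x + (1 - t) *: y).
Proof.
move=> cK x y Kx Ky t /andP[t0 t1].
have := cK x y (Itv01 t0 t1); rewrite !in_setE; exact.
Qed.

(** Points within [d / 2] of [x0] have depth at least [d / 2], and scale [4 / d] turns this into 2,
    where the cutoff equals 1. *)
Lemma cutoff_gint_gt0 (R : realType) (n : nat) (K : set 'rV[R]_n) (x0 : 'rV[R]_n) (d : R) :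
  (forall x y, K x -> K y -> forall t, 0 <= t <= 1 -> K (t *: x + (1 - t) *: y)) ->
  0 < d <= 1 -> (forall z, `|z - x0| < d -> K z) ->
  0 < gint (cutoff K (4 / d)).
Proof.
move=> cK /andP[d0 d1] Kd.
have [b b0 hb] := @gauss_iter_gt0 R n
  (* The coordinates of [x0] are continued by 0 from index [n] on. *)
  (fun j => oapp (fun i => x0 0 i) 0 (insub j : option 'I_n)) (d / 2) (divr_gt0 d0 (ltr0n _ 2)).
have nc : nice (cutoff K (4 / d)).
  split; first exact: cutoff_continuous.
  by exists 1 => // x; have /andP[? ?] := cutoff01 K (4 / d) x; rewrite ger0_norm.
apply: (lt_le_trans b0); rewrite -lee_fin -gauss_int_nice//.
apply: hb => [y|y yc _]; first by rewrite lee_fin; case/andP: (cutoff01 K (4 / d) (\row_i y i)).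
rewrite lee_fin cutoff_eq1//.
set z := \row_i y i.
have zx : `|z - x0| < d / 2.
  rewrite /Num.norm/= mx_normrE; apply/bigmax_ltP; split; first by rewrite divr_gt0.
  move=> -[i j] _ /=; rewrite (ord1 i) !mxE.
  by have := yc j (ltn_ord j); rewrite valK.
have : d / 2 <= depth K z.
  apply: depth_ge; first by lra.
  move=> w wz; apply: Kd; rewrite (_ : w - x0 = (w - z) + (z - x0)); last first.
    by rewrite addrA subrK.
  by rewrite (le_lt_trans (ler_normD _ _))//; lra.
rewrite -(ler_pM2l (divr_gt0 (ltr0n R 4) d0)); apply: le_trans.
rewrite (_ : 4 / d * (d / 2) = 2)//; field; exact: lt0r_neq0.
Qed.

Unset Implicit Arguments.

Theorem theorem1p3 (R : realType) (n : nat) (K : set 'rV[R]_n)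
  (u : 'rV[R]_n -> R) :
  convex_set (K : set (convex_lmodType 'rV[R]_n)) ->
  origin_symmetric K ->
  K° !=set0 ->
  C2 u ->
  (forall x, u (- x) = u x) ->
  (forall x, K x -> OU u x = 1) ->
  (gammaK_int K (fun x => (hs_norm2 (hessian u x) + eucl_norm2 (grad u x))%:E)
     >= ((n%:R)^-1)%:E)%E.
Proof.
move=> /convex_set_conv cK sK [x0 Kx0] uC2 uN uOU.
have Kx : K x0 by exact: interior_subset Kx0.
(* In dimension zero all sums are empty, so [OU u x0] would be 0 rather than 1. *)
have n0 : (0 < n)%N.
  rewrite lt0n; apply/eqP => nE.
  have := uOU x0 Kx; rewrite /OU /laplacian !big1 ?subr0.
  - by move/eqP; rewrite eq_sym oner_eq0.
  - by move=> [i il] _; exfalso; move: il; rewrite nE.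
  - by move=> [i il] _; exfalso; move: il; rewrite nE.
have [e e0 Ke] : exists2 e, 0 < e & forall z, `|z - x0| < e -> K z.
  have /nbhs_ballP[e /= e0 Ke] : nbhs x0 K by exact: Kx0.
  by exists e => // z zx; apply: Ke; rewrite -ball_normE /= distrC.
pose d := Num.min e 1.
have d0 : 0 < d by rewrite lt_min e0 ltr01.
have d1 : d <= 1 by rewrite ge_min lexx orbT.
have Kd z : `|z - x0| < d -> K z by move=> zx; apply: Ke; rewrite (lt_le_trans zx)// ge_min lexx.
rewrite /gammaK_int.
have gfin := gamma_n_fin K.
set X := gauss_int _.
have X0 : (0 <= X)%E.
  apply: gauss_int_ge0 => x; rewrite mule_ge0 ?lee_fin// addr_ge0//.
    by apply: sumr_ge0 => i _; apply: sumr_ge0 => j _; exact: sqr_ge0.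
  by apply: sumr_ge0 => i _; exact: sqr_ge0.
have g0 : 0 < fine (gamma_n K).
  rewrite (lt_le_trans (cutoff_gint_gt0 cK (introT andP (conj d0 d1)) Kd))//.
  rewrite -lee_fin (fineK gfin.1) -gauss_int_nice; last first.
    split; first exact: cutoff_continuous.
    by exists 1 => // x; have /andP[? ?] := cutoff01 K (4 / d) x; rewrite ger0_norm.
  apply: gauss_int_le => x; first by rewrite lee_fin; case/andP: (cutoff01 K (4 / d) x).
  rewrite lee_fin indicE; have /andP[c0 c1] := cutoff01 K (4 / d) x.
  move: c0; rewrite le_eqVlt => /predU1P[<-//|cx].
  by rewrite (mem_set (cutoff_in _ cx)) ?divr_gt0.
(* Infinite energy is immediate; for a finite value [c] the goal becomes
   [fine (gamma_n K) <= n%:R * c]. *)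
move: X0; case XE : X => [c| |] // X0; last first.
  by rewrite gt0_mulye ?leey// lte_fin invr_gt0.
rewrite -EFinM lee_fin ler_pdivlMr// ler_pdivrMl ?ltr0n//.
pose KM (m : nat) := K `&` [set x | `|x| <= m%:R].
have trunc m : fine (gamma_n K) <= fine (gamma_n (KM m)) + n%:R * tail m%:R.
  have [gMfin _] := gamma_n_fin (KM m).
  rewrite -lee_fin EFinD (fineK gfin.1) (fineK gMfin).
  have := @gauss_iter_truncate R n (fun y => (\1_K (\row_i y i))%:E) m%:R (fun=> 0).
  move=> H; apply: le_trans (H _) _.
    by move=> y; rewrite !lee_fin indicE; case: (_ \in _); rewrite /= lexx ler01.
  rewrite leeD2r//; apply: gauss_iter_le => y.
    by rewrite mule_ge0 ?lee_fin.
  move=> _; rewrite -EFinM lee_fin !indicE.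
  case: (boolP (y \in _)) => [/set_mem yM|_]; last by rewrite mul0r.
  case: (boolP (_ \in K)) => [/set_mem Ky|_]; last by rewrite mulr0.
  rewrite mem_set ?mulr1//; split=> //=.
  rewrite /Num.norm/= mx_normrE; apply/bigmax_leP; split=> // -[i j] _ /=.
  by rewrite !mxE; exact: yM.
have bound : \forall m \near \oo, fine (gamma_n (KM m)) <= n%:R * c.
  (* Beyond this index the ball of radius [d] around [x0] lies in [KM m], so the same scale [4 / d]
     gives a cutoff of positive mass. *)
  exists (Num.truncn (`|x0| + d)).+1 => // m /= mM.
  have mx : `|x0| + d < m%:R.
    by rewrite (lt_le_trans (truncnS_gt _))// ler_nat.
  apply: (@gamma_n_truncated_le R n K u cK sK uC2 uN uOU n0 m%:R (4 / d)) => //.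
  - by rewrite divr_gt0.
  - apply: (@cutoff_gint_gt0 R n _ x0 d) => //.
    + move=> x y [Kx' xM] [Ky' yM] t t01; split; first exact: cK.
      have := norm_segment_le t01 xM yM; rewrite (_ : _ + _ = t *: x + (1 - t) *: y)//.
      by rewrite scalerBr scalerBl scale1r addrCA addrC.
    + by rewrite d0.
    + move=> z zx; split; first exact: Kd.
      rewrite /= -(subrK x0 z) (le_trans (ler_normD _ _))//.
      by move: zx mx; rewrite addrC; lra.
  - by rewrite -XE.
have cvgt : (fun m : nat => n%:R * c + n%:R * tail m%:R : R) @ \oo --> n%:R * c.
  rewrite -[X in _ --> X]addr0; apply: cvgD; first exact: cvg_cst.
  rewrite -[X in _ --> X](mulr0 n%:R); apply: cvgM; [exact: cvg_cst|exact: cvg_tail].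
(* The Gaussian tails vanish as the truncation radius [m] grows, so the bound for the pieces passes
   to [K]. *)
rewrite -(cvg_lim (@Rhausdorff R) cvgt); apply: limr_ge.
  by apply/cvg_ex; exists (n%:R * c).
by apply: filterS bound => m mb; rewrite (le_trans (trunc m))// lerD2r.
Qed.
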